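(* Let $\Gamma$ be a Coxeter graph and let $\Gamma_1,\ldots,\Gamma_k$ be its connected components. Let $\mathrm{VA}[\Gamma]=H_1\times\cdots\times H_l$ be a Remak decomposition of $\mathrm{VA}[\Gamma]$, i.e. an (internal) direct product decomposition into subgroups $H_1,\dots,H_l$ each of which is non-trivial and indecomposable. Then $k=l$ and, up to a permutation of the factors, $H_i=\mathrm{VA}[\Gamma_i]$ for all $i\in\{1,\ldots,k\}$.
   Context: A Coxeter matrix on a countable (finite or infinite) set $S$ is a symmetric matrix $(m_{s,t})_{s,t\in S}$ with $m_{s,s}=1$ for all $s$ and $m_{s,t}\in\{2,3,4,\dots\}\cup\{\infty\}$ for $s\neq t$. It is encoded by the Coxeter graph $\Gamma$: the simplicial graph with vertex set $S$ in which distinct $s,t$ are joined by an edge iff $m_{s,t}\ge 3$, the edge being labeled by $m_{s,t}$ when $m_{s,t}\geq 4$ (including $\infty$). The virtual Artin group $\mathrm{VA}[\Gamma]$ is the group with generators $\{\sigma_s : s\in S\}\cup\{\tau_s : s\in S\}$ and relations: (VA1) $\cdots\sigma_s\sigma_t\sigma_s=\cdots\sigma_t\sigma_s\sigma_t$ (alternating words, both sides with $m_{s,t}$ letters, the left one ending in $\sigma_s$, the right one ending in $\sigma_t$) for all $s\ne t$ with $m_{s,t}\neq\infty$; (VA2) $\cdots\tau_s\tau_t\tau_s=\cdots\tau_t\tau_s\tau_t$ (both sides with $m_{s,t}$ letters) for all $s\neq t$ with $m_{s,t}\ne\infty$, and $\tau_s^2=\mathrm{id}$ for all $s\in S$; (VA3)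 for all $s\ne t$ with $m_{s,t}\neq\infty$, $P\,\sigma_t=\sigma_r\,P$, where $P=\cdots\tau_s\tau_t\tau_s$ is the alternating word in $\tau_s,\tau_t$ with $m_{s,t}-1$ letters ending in $\tau_s$, and $r=t$ if $m_{s,t}$ is even, $r=s$ if $m_{s,t}$ is odd. If $\Gamma_1,\dots,\Gamma_k$ are the connected components of $\Gamma$, then $\mathrm{VA}[\Gamma]=\mathrm{VA}[\Gamma_1]\times\cdots\times\mathrm{VA}[\Gamma_k]$, where $\mathrm{VA}[\Gamma_i]$ is identified with the subgroup of $\mathrm{VA}[\Gamma]$ generated by the $\sigma_s,\tau_s$ with $s$ a vertex of $\Gamma_i$. A group $G$ is decomposable if it is the (internal) direct product $G=H\times K$ of two proper subgroups $H,K$, and indecomposable otherwise. *)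

(* Defs.v *)
From HB Require Import structures.
From mathcomp Require Import all_boot.
From mathcomp Require Import generic_quotient.
From mathcomp Require Import boolp classical_sets functions.

Set Implicit Arguments.
Unset Strict Implicit.
Unset Printing Implicit Defensive.

Local Open Scope classical_set_scope.
Local Open Scope quotient_scope.
Local Open Scope group_scope.

(* The letter (x, false) stands for the generator x and (x, true) for its
   formal inverse. *)
Definition word (T : Type) := seq (T * bool).

Definition letter (T : Type) (x : T) : T * bool := (x, false).

Definition word_inv (T : Type) (w : word T) : word T :=
  rev [seq (x.1, ~~ x.2) | x <- w].

Section Presentation.
Variables (T : choiceType) (rels : word T -> word T -> Prop).

Inductive word_cong : word T -> word T -> Prop :=
| word_cong_refl u : word_cong u u
| word_cong_sym u v : word_cong u v -> word_cong v u
| word_cong_trans v u w : word_cong u v -> word_cong v w -> word_cong u w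
| word_cong_cat u u' v v' :
    word_cong u u' -> word_cong v v' -> word_cong (u ++ v) (u' ++ v')
| word_cong_cancel x b : word_cong [:: (x, b); (x, ~~ b)] [::]
| word_cong_rel u v : rels u v -> word_cong u v.

Definition word_congb : rel (word T) := fun u v => `[< word_cong u v >].

Fact word_congb_refl : reflexive word_congb.
Proof. by move=> u; apply/asboolP; exact: word_cong_refl. Qed.

Fact word_congb_sym : symmetric word_congb.
Proof. by move=> u v; apply/asboolP/asboolP; exact: word_cong_sym. Qed.

Fact word_congb_trans : transitive word_congb.
Proof.
move=> v u w /asboolP uv /asboolP vw; apply/asboolP.
exact: word_cong_trans uv vw.
Qed.

Canonical word_cong_equiv :=
  EquivRel word_congb word_congb_refl word_congb_sym word_congb_trans.

Definition presented_group := {eq_quot word_cong_equiv}.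

HB.instance Definition _ := Choice.on presented_group.

Definition class_of_word (w : word T) : presented_group :=
  \pi_({eq_quot word_cong_equiv}) w.

Definition word_of_class (x : presented_group) : word T :=
  repr (x : {eq_quot word_cong_equiv}).

Fact word_of_classK : cancel word_of_class class_of_word.
Proof. by move=> x; exact: reprK. Qed.

Fact class_of_wordP (u v : word T) :
  class_of_word u = class_of_word v <-> word_cong u v.
Proof.
split=> [/eqmodP/asboolP // | uv].
by apply/eqmodP/asboolP.
Qed.

Fact class_of_wordK (u : word T) : word_cong (word_of_class (class_of_word u)) u.
Proof. by apply/class_of_wordP; rewrite word_of_classK. Qed.

Definition pg_one : presented_group := class_of_word [::].
Definition pg_mul (x y : presented_group) : presented_group :=
  class_of_word (word_of_class x ++ word_of_class y).
Definition pg_inv (x : presented_group) : presented_group :=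
  class_of_word (word_inv (word_of_class x)).

Fact class_of_word_cat (u v : word T) :
  class_of_word (u ++ v) = pg_mul (class_of_word u) (class_of_word v).
Proof.
by apply/class_of_wordP; apply: word_cong_cat;
  apply: word_cong_sym; exact: class_of_wordK.
Qed.

Fact word_invK : involutive (@word_inv T).
Proof.
move=> w; rewrite /word_inv map_rev revK -map_comp -[RHS]map_id.
by apply: eq_map => -[x b] /=; rewrite negbK.
Qed.

Fact word_mulV (w : word T) : word_cong (w ++ word_inv w) [::].
Proof.
elim: w => [|[x b] w IH]; first exact: word_cong_refl.
rewrite /word_inv /= rev_cons -/(word_inv w) -cats1 catA.
apply: (word_cong_trans (v := [:: (x, b)] ++ ([::] ++ [:: (x, ~~ b)]))); last first.
  exact: word_cong_cancel.
rewrite -cat1s; apply: word_cong_cat; first exact: word_cong_refl.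
by apply: word_cong_cat IH _; exact: word_cong_refl.
Qed.

Fact pg_mulA : associative pg_mul.
Proof.
move=> x y z; rewrite -(word_of_classK x) -(word_of_classK y) -(word_of_classK z).
by rewrite -!class_of_word_cat catA.
Qed.

Fact pg_mul1 : left_id pg_one pg_mul.
Proof.
by move=> x; rewrite -(word_of_classK x) /pg_one -class_of_word_cat.
Qed.

Fact pg_mulr1 : right_id pg_one pg_mul.
Proof.
by move=> x; rewrite -(word_of_classK x) /pg_one -class_of_word_cat cats0.
Qed.

Fact pg_mulrV : right_inverse pg_one pg_inv pg_mul.
Proof.
move=> x; rewrite -{1}(word_of_classK x) /pg_inv -class_of_word_cat.
by apply/class_of_wordP; exact: word_mulV.
Qed.

Fact pg_mulV : left_inverse pg_one pg_inv pg_mul.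
Proof.
move=> x; rewrite -{2}(word_of_classK x) /pg_inv -class_of_word_cat.
apply/class_of_wordP; rewrite -{2}[word_of_class x]word_invK.
exact: word_mulV.
Qed.

HB.instance Definition _ := isGroup.Build presented_group
  pg_mulA pg_mul1 pg_mulr1 pg_mulV pg_mulrV.

End Presentation.

(* None encodes the label infinity. *)
Record coxeter_matrix (S : Type) := CoxeterMatrix {
  cox_label :> S -> S -> option nat;
  cox_label_sym : forall s t, cox_label s t = cox_label t s;
  cox_label_diag : forall s, cox_label s s = Some 1%N;
  cox_label_ge2 : forall s t n, s <> t -> cox_label s t = Some n -> (2 <= n)%N
}.

Definition coxeter_edge (S : eqType) (M : coxeter_matrix S) : rel S :=
  fun s t => (s != t) && (if M s t is Some n then (3 <= n)%N else true).

Definition coxeter_component (S : eqType) (M : coxeter_matrix S) (s : S) :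
    set S :=
  [set t | exists2 p : seq S, path (coxeter_edge M) s p & last s p = t].

Definition enumerates_components (S : eqType) (M : coxeter_matrix S) (k : nat)
    (C : 'I_k -> set S) : Prop :=
  injective C /\ range C = range (coxeter_component M).

(* The alternating word ... x y x with n letters, its last letter being x. *)
Fixpoint alt_word (A : Type) (n : nat) (x y : A) : seq A :=
  if n is n'.+1 then rcons (alt_word n' y x) x else [::].

Definition sigl (S : Type) (s : S) : (S + S) * bool := letter (inl s).
Definition taul (S : Type) (s : S) : (S + S) * bool := letter (inr s).

Section VirtualArtin.
Variables (S : countType) (M : coxeter_matrix S).

Inductive va_rel : word (S + S) -> word (S + S) -> Prop :=
| VA1 s t n : s <> t -> M s t = Some n ->
    va_rel (alt_word n (sigl s) (sigl t)) (alt_word n (sigl t) (sigl s))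
| VA2 s t n : s <> t -> M s t = Some n ->
    va_rel (alt_word n (taul s) (taul t)) (alt_word n (taul t) (taul s))
| VA2_involution s : va_rel [:: taul s; taul s] [::]
| VA3 s t n : s <> t -> M s t = Some n ->
    va_rel (rcons (alt_word n.-1 (taul s) (taul t)) (sigl t))
           (sigl (if odd n then s else t) ::
              alt_word n.-1 (taul s) (taul t)).

Definition virtual_artin := presented_group va_rel.

HB.instance Definition _ := Group.on virtual_artin.

Definition sigma (s : S) : virtual_artin := class_of_word va_rel [:: sigl s].
Definition tau (s : S) : virtual_artin := class_of_word va_rel [:: taul s].

End VirtualArtin.

Definition is_subgroup (G : groupType) (H : set G) : Prop := group_closed [in H].

Definition generated_subgroup (G : groupType) (X : set G) : set G :=
  smallest (@is_subgroup G) X.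

Definition va_parabolic (S : countType) (M : coxeter_matrix S) (C : set S) :
    set (virtual_artin M) :=
  generated_subgroup (@sigma S M @` C `|` @tau S M @` C).
Arguments va_parabolic {S} M C.

(* D is the internal direct product of the H i: the multiplication map from the
   external product of the H i to D is a group isomorphism, the commutation
   condition saying that it is a morphism. *)
Definition internal_direct_product (G : groupType) (D : set G) (n : nat)
    (H : 'I_n -> set G) : Prop :=
  [/\ is_subgroup D, forall i, is_subgroup (H i),
      forall i j, i != j -> forall x y, H i x -> H j y -> commute x y
    & set_bij [set h : 'I_n -> G | forall i, H i (h i)] D
        (fun h => \prod_(i < n) h i)].

Definition decomposable (G : groupType) (D : set G) : Prop :=
  exists H K : set G,
    [/\ H <> D, K <> D & internal_direct_product D (tnth [tuple H; K])].

Definition Remak_decomposition (G : groupType) (l : nat) (H : 'I_l -> set G) :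
    Prop :=
  internal_direct_product [set: G] H /\
  forall i, H i <> [set 1] /\ ~ decomposable (H i).

(* Main.v *)
(** Sending every sigma_s to 1 and tau_s to s splits VA off the Coxeter group W;
    the kernel F is the Artin group generated by the "roots" w sigma_s w^-1,
    with a braid relation only between roots of the form w sigma_s w^-1 and
    w sigma_t w^-1. In particular there is no relation between a root b and its
    opposite -b, so F is an amalgam of the subgroups generated by the roots
    other than -b, resp. b, and the normal form theorem shows that of two
    commuting normal subgroups of F one avoids b, i.e. lies in the subgroup
    generated by the other roots. An element avoiding a set of roots lies in the
    subgroup generated by the remaining ones: as in Charney and Paris, this
    follows from a Coxeter group acting, with labels, on the minimal
    representatives of its cosets modulo a parabolic subgroup. Hence F has
    trivial centralizer. If VA = A x B, the set I of those s such that
    A /\ F avoids sigma_s is then a union of components, since for s in I and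
    t not in I, killing the sigmas outside I, or those in I, shows that sigma_s
    and sigma_t commute; so each VA[Gamma_i] lies in A or in B. *)

Require Import Defs.
From HB Require Import structures.
From mathcomp Require Import all_boot all_fingroup ssralg ssrnum poly algC cyclotomic ring.
From mathcomp Require Import boolp classical_sets functions.

Set Implicit Arguments.
Unset Strict Implicit.
Unset Printing Implicit Defensive.

Local Open Scope classical_set_scope.
Local Open Scope group_scope.

(** * Groups, presentations, permutations and wreath products *)

(** The Coxeter group that acts on cosets is not [W]: its generators are the roots themselves,
    labelled by the lengths of the braid relations of F. This is why Coxeter groups are treated over
    an arbitrary set of generators, with words of minimal length in place of the geometry of root
    vectors. Both the action on cosets and the normal forms reach F only through its universal
    property: a permutation is attached to every root, and the braid relations are checked. The
    obstacle at the end is that a direct factor A need not be the product of its intersections with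
    F and with the copy of [W], so that knowing A /\ F says little about A. The bridge is that F has
    trivial centralizer in the whole of VA, not just in F. If A /\ F avoids the roots of a component
    U, the commutators of an element of A in VA[U] with the roots lie both in VA[U] and in A /\ F;
    the retraction of VA onto VA[U] fixes them and also kills them, so the element is trivial. *)

Definition is_hom (G H : groupType) (f : G -> H) : Prop := {morph f : x y / x * y}.

Section Hom.
Variables (G H : groupType) (f : G -> H) (hf : is_hom f).

Lemma hom1 : f 1 = 1.
Proof. by apply: (mulgI (f 1)); rewrite -hf !mulg1. Qed.

Lemma homV x : f x^-1 = (f x)^-1.
Proof. by apply: (mulgI (f x)); rewrite -hf !mulgV hom1. Qed.

Lemma homX x n : f (x ^+ n) = f x ^+ n.
Proof. by elim: n => [|n IH]; rewrite ?expg0 ?hom1 // !expgS hf IH. Qed.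

Lemma homJ x y : f (x ^ y) = f x ^ f y.
Proof. by rewrite /conjg !hf homV. Qed.

Lemma homR x y : f [~ x, y] = [~ f x, f y].
Proof. by rewrite /commg hf homV homJ. Qed.

End Hom.

(** An inductive form of [generated_subgroup], which allows induction on the way an element is
    generated. *)
Inductive gspan (G : groupType) (X : set G) : set G :=
| gspan_in x : X x -> gspan X x
| gspan1 : gspan X 1
| gspanM x y : gspan X x -> gspan X y -> gspan X (x * y)
| gspanV x : gspan X x -> gspan X x^-1.
Arguments gspan1 {G X}.

Section Generated.
Variable G : groupType.
Implicit Types X Y : set G.

Lemma is_subgroupP X :
  is_subgroup X <-> X 1 /\ (forall x y, X x -> X y -> X (x * y)) /\ (forall x, X x -> X x^-1).
Proof.
split=> [hX|[h1 [hM hV]]]; last first.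
  split; first exact/asboolP.
  by move=> x y /asboolP hx /asboolP hy; apply/asboolP/hM/hV.
split; first by case: hX => /asboolP.
split=> [x y hx hy|x hx].
  by apply/asboolP; apply: (group_closedM hX); exact/asboolP.
by apply/asboolP; apply: (group_closedV hX); exact/asboolP.
Qed.

Lemma gspan_subgroup X : is_subgroup (gspan X).
Proof.
by apply/is_subgroupP; split; [exact: gspan1 | split=> *; [exact: gspanM|exact: gspanV]].
Qed.

Lemma gspan_sub X Y : is_subgroup Y -> X `<=` Y -> gspan X `<=` Y.
Proof.
move=> /is_subgroupP[h1 [hM hV]] hXY x; elim=> {x}; [exact: hXY|by []| |].
- by move=> x y _ hx _ hy; exact: hM.
- by move=> x _ hx; exact: hV.
Qed.

Lemma gspan_subset X Y : X `<=` Y -> gspan X `<=` gspan Y.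
Proof. by move=> h; apply: gspan_sub (gspan_subgroup Y) _ => x /h; exact: gspan_in. Qed.

Lemma generated_subgroupE X : generated_subgroup X = gspan X.
Proof.
apply/seteqP; split=> x; first by apply; split; [exact: gspan_subgroup|exact: gspan_in].
by move=> hx Y [hY hXY]; exact: (gspan_sub hY hXY).
Qed.

Lemma gspanX X x n : gspan X x -> gspan X (x ^+ n).
Proof.
by move=> hx; elim: n => [|n IH]; rewrite ?expgS ?expg0; [exact: gspan1|exact: gspanM].
Qed.

Lemma gspan0 (x : G) : gspan set0 x -> x = 1.
Proof.
by elim=> {x} // [x y _ -> _ ->|x _ ->]; rewrite ?mulg1 ?invg1.
Qed.

(** Serves where only the product of a single generator with a known element is under control, as
    for normal forms. *)
Lemma gspan_ind_l X (P : G -> Prop) :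
  P 1 -> (forall x f, X x -> P f -> P (x * f) /\ P (x^-1 * f)) -> forall f, gspan X f -> P f.
Proof.
move=> h1 hX f hf.
suff [h _] : (forall g, P g -> P (f * g)) /\ (forall g, P g -> P (f^-1 * g)).
  by rewrite -[f]mulg1; exact: h.
elim: hf => {f} [x Xx||x y _ [hx hx'] _ [hy hy']|x _ [hx hx']].
- by split=> g /(hX x g Xx)[].
- by rewrite invg1; split=> g; rewrite mul1g.
- by rewrite invgM; split=> g hg; rewrite -mulgA; [exact/hx/hy|exact/hy'/hx'].
- by rewrite invgK.
Qed.

Lemma gspan_finite X f : gspan X f ->
  exists2 s : seq G, (forall x, x \in s -> X x) & gspan [set x | x \in s] f.
Proof.
elim=> {f} [x Xx||x y _ [s hs hx] _ [t ht hy]|x _ [s hs hx]].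
- by exists [:: x] => [y|]; [rewrite inE => /eqP->|apply: gspan_in; rewrite /= inE].
- by exists [::] => //; exact: gspan1.
- exists (s ++ t) => [z|]; first by rewrite mem_cat => /orP[/hs|/ht].
  apply: gspanM; [move: hx|move: hy]; apply: gspan_subset => z /= hz;
  by rewrite mem_cat hz ?orbT.
- by exists s; [exact: hs|exact: (gspanV hx)].
Qed.

Lemma commute_gspan X Y :
  (forall x y, X x -> Y y -> commute x y) -> forall x y, gspan X x -> gspan Y y -> commute x y.
Proof.
move=> h x y hx hy.
have hxy z : X z -> commute z y.
  move=> Xz; elim: hy => {y} [y Yy||y t _ hy _ ht|y _ hy].
  - exact: h.
  - exact: commute1.
  - exact: commuteM.
  - exact: commuteV.
elim: hx => {x} [x /hxy //||x t _ hx _ ht|x _ hx].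
- exact/commute_sym/commute1.
- by apply/commute_sym/commuteM; exact/commute_sym.
- by apply/commute_sym/commuteV/commute_sym.
Qed.

End Generated.

Lemma gspan_hom (G H : groupType) (f : G -> H) (X : set G) (Y : set H) : is_hom f ->
  (forall x, X x -> gspan Y (f x)) -> forall x, gspan X x -> gspan Y (f x).
Proof.
move=> hf hX x; elim=> {x} [x /hX //||x y _ hx _ hy|x _ hx].
- by rewrite hom1 //; exact: gspan1.
- by rewrite hf; exact: gspanM.
- by rewrite homV //; exact: gspanV.
Qed.

Section Lift.
Variables (T : choiceType) (rels : word T -> word T -> Prop).

Definition pgen (x : T) : presented_group rels := class_of_word rels [:: letter x].

Lemma pg_mulE (u v : word T) :
  class_of_word rels (u ++ v) = class_of_word rels u * class_of_word rels v.
Proof. exact: class_of_word_cat. Qed.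

Lemma pg_ind (P : presented_group rels -> Prop) :
  P 1 -> (forall x y, P x -> P y -> P (x * y)) -> (forall x, P x -> P x^-1) ->
  (forall x, P (pgen x)) -> forall x, P x.
Proof.
move=> h1 hM hV hg x; rewrite -(word_of_classK x).
elim: (word_of_class x) => [|[y b] w IH]; first exact: h1.
rewrite -cat1s pg_mulE; apply: hM => //; case: b; last exact: hg.
have -> : class_of_word rels [:: (y, true)] = (pgen y)^-1; last exact/hV/hg.
apply: (mulgI (pgen y)); rewrite mulgV /pgen -pg_mulE.
by apply/class_of_wordP; exact: (word_cong_cancel _ y false).
Qed.

Variables (H : groupType) (f : T -> H).

Definition eval_word (w : word T) : H :=
  foldr (fun x h => (if x.2 then (f x.1)^-1 else f x.1) * h) 1 w.

Lemma eval_cat u v : eval_word (u ++ v) = eval_word u * eval_word v.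
Proof. by elim: u => [|x u IH] /=; rewrite ?mul1g // IH mulgA. Qed.

Definition respects := forall u v, rels u v -> eval_word u = eval_word v.

Definition pg_lift (x : presented_group rels) : H := eval_word (word_of_class x).

Hypothesis hf : respects.

Lemma eval_cong u v : word_cong rels u v -> eval_word u = eval_word v.
Proof.
elim=> {u v} [//|u v _ -> //|u v w _ -> _ -> //|u u' v v' _ hu _ hv|x [] /=|u v /hf //].
- by rewrite !eval_cat hu hv.
- by rewrite mulg1 mulVg.
- by rewrite mulg1 mulgV.
Qed.

Lemma pg_lift_class u : pg_lift (class_of_word rels u) = eval_word u.
Proof. by apply: eval_cong; exact: class_of_wordK. Qed.

Lemma pg_liftM : is_hom pg_lift.
Proof.
move=> x y; rewrite -{1}(word_of_classK x) -{1}(word_of_classK y) -pg_mulE.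
by rewrite pg_lift_class eval_cat.
Qed.

Lemma pg_liftE x : pg_lift (pgen x) = f x.
Proof. by rewrite pg_lift_class /= mulg1. Qed.

End Lift.

Section Altp.
Variable G : groupType.

Fixpoint altp (n : nat) (x y : G) : G :=
  if n is n'.+1 then altp n' y x * x else 1.

Lemma mulg_expC m (x y : G) : (x * y) ^+ m * x = x * (y * x) ^+ m.
Proof.
by elim: m => [|m IH]; rewrite ?expg0 ?mulg1 ?mul1g // expgS -!mulgA IH expgS !mulgA.
Qed.

Lemma altpE n (x y : G) : altp n x y = (if odd n then x else 1) * (y * x) ^+ n./2.
Proof.
elim: n x y => [|n IH] x y /=; first by rewrite mulg1.
rewrite IH uphalf_half; case: (odd n) => /=.
  by rewrite mul1g add1n expgS -!mulgA mulg_expC.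
by rewrite mul1g add0n mulg_expC.
Qed.

Lemma altp_exp n x y : x * x = 1 -> y * y = 1 ->
  (altp n x y = altp n y x) <-> (x * y) ^+ n = 1.
Proof.
move=> hx hy; have xV : x^-1 = x by apply: mulg1_eq.
have yV : y^-1 = y by apply: mulg1_eq.
have xyV k : ((x * y) ^+ k)^-1 = (y * x) ^+ k by rewrite -expVgn invgM xV yV.
rewrite !altpE; set k := n./2.
have hn : n = (odd n + (k + k))%N by rewrite addnn odd_double_half.
rewrite {3}hn expgnDr expgnDr; case: (odd n) => /=; last first.
  rewrite !mul1g -{1}(xyV k); split=> h; last by apply/esym/(mulgI ((x*y)^+k)); rewrite h mulgV.
  by rewrite -{1}h mulVg.
rewrite expg1; split=> [h|h].
  have : x * (x * (y * x) ^+ k) = x * (y * (x * y) ^+ k) by rewrite h.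
  rewrite !mulgA hx mul1g -(xyV k) => e.
  by rewrite -[_ * (x * y) ^+ k * _]mulgA mulgA -e mulVg.
apply: (mulgI x); rewrite !mulgA hx mul1g -(xyV k).
by apply: (mulIg ((x * y) ^+ k)); rewrite mulVg -h !mulgA.
Qed.

(** For involutions the factor gained on the right is a reflection; [alt_refl] names it in Coxeter
    groups. *)
Lemma altpSr n x y : x * x = 1 -> y * y = 1 ->
  altp n.+1 x y = altp n x y * (x * (y * x) ^+ n).
Proof.
elim: n x y => [|n IH] x y hx hy /=; first by rewrite mulg1.
rewrite -[altp n x y * y]/(altp n.+1 y x) IH // -!mulgA; congr (_ * _).
by rewrite [x * (x * _)]mulgA hx mul1g mulg_expC expgS !mulgA.
Qed.

Lemma altpSl n (x y : G) : altp n.+1 x y = (if odd n then y else x) * altp n x y.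
Proof.
elim: n x y => [|n IH] x y; first by rewrite /= mul1g mulg1.
by rewrite [LHS]/= -/(altp n.+1 y x) IH -mulgA /=; case: (odd n).
Qed.

End Altp.

Lemma altp_hom (G H : groupType) (f : G -> H) n x y : is_hom f -> f (altp n x y) = altp n (f x) (f y).
Proof. by move=> hf; elim: n x y => [|n IH] x y /=; rewrite ?hom1 // hf IH. Qed.

Lemma eval_alt (T : choiceType) (H : groupType) (f : T -> H) n x y :
  eval_word f (alt_word n (letter x) (letter y)) = altp n (f x) (f y).
Proof.
elim: n x y => [|n IH] x y //=.
by rewrite -cats1 eval_cat IH /= mulg1.
Qed.

(** The inverse is part of the data, since the sets acted on are infinite. *)
Record sym (T : Type) := Sym {
  sym_fun :> T -> T; sym_inv : T -> T;
  symK : cancel sym_fun sym_inv; symVK : cancel sym_inv sym_fun }.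

Section Sym.
Variable T : Type.
Implicit Types f g : sym T.

Lemma symP f g : f =1 g -> f = g.
Proof.
case: f g => [f f' fK f'K] [g g' gK g'K] /= h.
have e : f = g by apply/funext.
subst g; have e' : f' = g' by apply/funext => x; rewrite -[x in LHS]g'K fK.
by subst g'; congr Sym; exact: Prop_irrelevance.
Qed.

HB.instance Definition _ := gen_eqMixin (sym T).
HB.instance Definition _ := gen_choiceMixin (sym T).

Definition sym_one : sym T := @Sym T id id (frefl _) (frefl _).
Definition sym_mul f g : sym T :=
  Sym (can_comp (symK f) (symK g)) (can_comp (symVK g) (symVK f)).
Definition sym_invg f : sym T := Sym (symVK f) (symK f).

Lemma sym_mulA : associative sym_mul. Proof. by move=> f g h; exact: symP. Qed.
Lemma sym_mul1 : left_id sym_one sym_mul. Proof. by move=> f; exact: symP. Qed.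
Lemma sym_mulr1 : right_id sym_one sym_mul. Proof. by move=> f; exact: symP. Qed.
Lemma sym_mulV : left_inverse sym_one sym_invg sym_mul.
Proof. by move=> f; apply: symP => x /=; exact: symK. Qed.
Lemma sym_mulrV : right_inverse sym_one sym_invg sym_mul.
Proof. by move=> f; apply: symP => x /=; exact: symVK. Qed.

HB.instance Definition _ := isGroup.Build (sym T)
  sym_mulA sym_mul1 sym_mulr1 sym_mulV sym_mulrV.

Lemma symM f g x : (f * g) x = f (g x). Proof. by []. Qed.
Lemma sym1 x : (1 : sym T) x = x. Proof. by []. Qed.
Lemma symVE f x y : f x = y -> f^-1 y = x. Proof. by move=> <-; exact: symK. Qed.

End Sym.

Section Wreath.
Variables (X : Type) (W H : groupType) (act : W -> X -> X).

(** The unrestricted wreath product over the [W]-set [X]. The action laws are parameters of the type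
    because its group structure depends on them. *)
Definition wreath of act 1 =1 id & forall v w x, act (v * w) x = act v (act w x) : Type :=
  ((X -> H) * W)%type.

Hypotheses (act1 : act 1 =1 id) (actM : forall v w x, act (v * w) x = act v (act w x)).
Local Notation wr := (wreath act1 actM).

HB.instance Definition _ := gen_eqMixin wr.
HB.instance Definition _ := gen_choiceMixin wr.

Definition wr_one : wr := (fun=> 1, 1).
Definition wr_mul (a b : wr) : wr := (fun x => a.1 (act b.2 x) * b.1 x, a.2 * b.2).
Definition wr_inv (a : wr) : wr := (fun x => (a.1 (act a.2^-1 x))^-1, a.2^-1).

Lemma wrP (a b : wr) : a.1 =1 b.1 -> a.2 = b.2 -> a = b.
Proof. by case: a b => [f v] [g w] /= /funext -> ->. Qed.

Lemma wr_mulA : associative wr_mul.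
Proof. by move=> a b c; apply: wrP => [x|] /=; rewrite ?actM mulgA. Qed.
Lemma wr_mul1 : left_id wr_one wr_mul.
Proof. by move=> a; apply: wrP => [x|] /=; rewrite mul1g. Qed.
Lemma wr_mulr1 : right_id wr_one wr_mul.
Proof. by move=> a; apply: wrP => [x|] /=; rewrite ?act1 mulg1. Qed.
Lemma wr_mulV : left_inverse wr_one wr_inv wr_mul.
Proof.
by move=> a; apply: wrP => [x|] /=; rewrite -?actM mulVg // act1 mulVg.
Qed.
Lemma wr_mulrV : right_inverse wr_one wr_inv wr_mul.
Proof. by move=> a; apply: wrP => [x|] /=; rewrite mulgV. Qed.

HB.instance Definition _ := isGroup.Build wr wr_mulA wr_mul1 wr_mulr1 wr_mulV wr_mulrV.

Lemma wrME (a b : wr) x : (a * b).1 x = a.1 (act b.2 x) * b.1 x. Proof. by []. Qed.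
End Wreath.

(** * Coxeter groups and their reflection representation *)

Section CoxeterGroup.
Variables (I : choiceType) (M : coxeter_matrix I).

Inductive cox_rel : word I -> word I -> Prop :=
| cox_braid i j n : i <> j -> M i j = Some n ->
    cox_rel (alt_word n (letter i) (letter j)) (alt_word n (letter j) (letter i))
| cox_involution i : cox_rel [:: letter i; letter i] [::].

Definition cox := presented_group cox_rel.
HB.instance Definition _ := Group.on cox.

Definition cgen (i : I) : cox := pgen cox_rel i.

Lemma cgenK i : cgen i * cgen i = 1.
Proof. by rewrite -pg_mulE; apply/class_of_wordP/word_cong_rel; exact: cox_involution. Qed.

Lemma cgenV i : (cgen i)^-1 = cgen i.
Proof. exact/mulg1_eq/cgenK. Qed.

Definition cox_respects (H : groupType) (f : I -> H) :=
  (forall i, f i * f i = 1) /\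
  (forall i j n, i <> j -> M i j = Some n -> altp n (f i) (f j) = altp n (f j) (f i)).

Definition cox_lift (H : groupType) (f : I -> H) : cox -> H := @pg_lift _ cox_rel H f.

Section CoxLift.
Variables (H : groupType) (f : I -> H) (hf : cox_respects f).

Lemma cox_respectsP : respects cox_rel f.
Proof.
case: hf => h1 h2 u v [i j n hij hM|i]; first by rewrite !eval_alt; exact: h2 hij hM.
by rewrite /= mulg1 h1.
Qed.

Lemma cox_liftM : is_hom (cox_lift f). Proof. exact: pg_liftM cox_respectsP. Qed.
Lemma cox_liftE i : cox_lift f (cgen i) = f i. Proof. exact: pg_liftE cox_respectsP _. Qed.
End CoxLift.

Lemma cgen_braid i j n : i <> j -> M i j = Some n ->
  altp n (cgen i) (cgen j) = altp n (cgen j) (cgen i).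
Proof.
have e k x y : altp k (cgen x) (cgen y) = class_of_word cox_rel (alt_word k (letter x) (letter y)).
  by elim: k x y => [|k IH] x y //=; rewrite IH -cats1 pg_mulE.
by move=> hij hM; rewrite !e; apply/class_of_wordP/word_cong_rel/cox_braid.
Qed.

Lemma cgen_exp i j n : i <> j -> M i j = Some n -> (cgen i * cgen j) ^+ n = 1.
Proof. by move=> hij /(cgen_braid hij)/(altp_exp n (cgenK i) (cgenK j)). Qed.

Definition wprod (s : seq I) : cox := foldr (fun i x => cgen i * x) 1 s.

Lemma wprod_cat s s' : wprod (s ++ s') = wprod s * wprod s'.
Proof. by elim: s => [|i s IH] /=; rewrite ?mul1g // IH mulgA. Qed.

Lemma wprodV s : (wprod s)^-1 = wprod (rev s).
Proof.
elim: s => [|i s IH] /=; first by rewrite invg1.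
by rewrite invgM IH rev_cons -cats1 wprod_cat /= mulg1 cgenV.
Qed.

Lemma cox_word (w : cox) : exists s, w = wprod s.
Proof.
elim/(@pg_ind I cox_rel): w => [|x y [s ->] [t ->]|x [s ->]|i].
- by exists [::].
- by exists (s ++ t); rewrite wprod_cat.
- by exists (rev s); rewrite wprodV.
- by exists [:: i]; rewrite /= mulg1.
Qed.

Section Tits.
Import GRing.Theory Num.Theory.

(* For the label infinity [zeta] is 2: any element of infinite order would do. *)
Lemma zeta_exists (o : option nat) : o <> Some 0%N ->
  exists z : algC, (z != 0)%R /\
    forall k, (z ^+ (k + k) = 1)%R <-> k = 0%N \/ exists2 n, o = Some n & (n %| k)%N.
Proof.
case: o => [[//|n]|] _.
  (* The order is twice the label because the product of two reflections has eigenvalues z^2 and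
     z^-2. *)
  have [z hz] := @C_prim_root_exists (n.+1 + n.+1) isT.
  exists z; split.
    apply/eqP => z0; have := prim_expr_order hz.
    by rewrite z0 addnS expr0n /= => /eqP; rewrite eq_sym oner_eq0.
  have dk k : ((n.+1 + n.+1) %| (k + k))%N = (n.+1 %| k)%N.
    by rewrite !addnn -!mul2n dvdn_pmul2l.
  move=> k; split=> [/eqP|].
    by rewrite -(prim_order_dvd hz) dk => h; right; exists n.+1.
  by case=> [-> //|[m [<-]] h]; apply/eqP; rewrite -(prim_order_dvd hz) dk.
exists 2%R; split; first by rewrite pnatr_eq0.
move=> k; split=> [|[-> //|[n]//]]; case: k => [|k]; first by left.
rewrite -natrX => /eqP; rewrite -[1%R]/(1%:R)%R eqr_nat addSn expnS => /eqP h.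
by have := congr1 odd h; rewrite oddM.
Qed.

Definition zeta (o : option nat) : algC :=
  if pselect (o <> Some 0%N) is left h then projT1 (cid (zeta_exists h)) else 1%R.

Lemma label_neq0 i j : M i j <> Some 0%N.
Proof.
move=> h; have [e|e] := pselect (i = j).
  by move: h; rewrite e cox_label_diag.
by have := cox_label_ge2 e h.
Qed.

Lemma zetaP i j : (zeta (M i j) != 0)%R /\
  forall k, ((zeta (M i j)) ^+ (k + k) = 1)%R <-> k = 0%N \/ exists2 n, M i j = Some n & (n %| k)%N.
Proof.
rewrite /zeta; case: pselect => [h|]; last by move=> h; exfalso; exact/h/label_neq0.
exact: (projT2 (cid (zeta_exists h))).
Qed.

(* The reflection representation acts here on all functions on [I], so that no
   finite support is needed; [- (zeta + zeta^-1)] is [-2 cos (pi / m)] for a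
   finite label [m]. *)
Definition cartan i j : algC :=
  (if i == j then 2 else - (zeta (M i j) + (zeta (M i j))^-1))%R.

Definition refl i (f : I -> algC) : I -> algC := (fun k => f k - f i * cartan i k)%R.

Lemma reflK i : cancel (refl i) (refl i).
Proof.
move=> f; apply/funext => k; rewrite /refl {2}/cartan eqxx; ring.
Qed.

Definition sym_refl i : sym (I -> algC) := Sym (reflK i) (reflK i).

(** The linear forms f i + z f j, for z equal to [zeta] or to its inverse, are eigenforms of the
    product of the two reflections; [e] selects one of them. *)
Lemma zeta_pair i j (f : I -> algC) (e : bool) : i <> j ->
  let z := (if e then zeta (M i j) else (zeta (M i j))^-1)%R in
  let f' := refl i (refl j f) in
  (f' i + z * f' j = z ^+ 2 * (f i + z * f j))%R.
Proof.
move=> hij z f'.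
have [z0 _] := zetaP i j.
have z0' : (z != 0)%R by rewrite /z; case: e {z f'}; rewrite ?invr_eq0.
have eij : cartan i j = (- (z + z^-1))%R.
  by rewrite /cartan (introF eqP hij) /z; case: e {z f' z0'} => //; rewrite invrK addrC.
have eji : cartan j i = (- (z + z^-1))%R.
  rewrite -eij /cartan (introF eqP hij) cox_label_sym eq_sym (introF eqP hij) //.
rewrite /f' /refl eij eji /cartan !eqxx; field; exact: z0'.
Qed.

Lemma refl_iter i j (f : I -> algC) (e : bool) k : i <> j ->
  let z := (if e then zeta (M i j) else (zeta (M i j))^-1)%R in
  let f' := ((sym_refl i * sym_refl j) ^+ k) f in
  (f' i + z * f' j = z ^+ (k + k) * (f i + z * f j))%R.
Proof.
move=> hij z; elim: k => [|k IH] /=; first by rewrite expr0 mul1r.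
by rewrite expgS 2!symM [LHS](zeta_pair _ e hij) -/z IH addnS addSn [in RHS]exprS [in RHS]exprS; ring.
Qed.

(** The two eigenforms, being independent, show that the values at [i] and [j] come back after n
    rounds. The total change is a combination X, Y of the rows [i] and [j] of [cartan], so X and Y
    solve a homogeneous system with determinant -(z - z^-1)^2, which is not 0. *)
Lemma sym_refl_exp i j n : i <> j -> M i j = Some n -> (sym_refl i * sym_refl j) ^+ n = 1.
Proof.
move=> hij hM; have [z0 hz] := zetaP i j.
set z := zeta (M i j) in z0 hz.
have zn : (z ^+ (n + n) = 1)%R by apply/hz; right; exists n.
have z1 : (z ^+ 2 != 1)%R.
  apply/eqP => h; have /hz[//|[m]] : (z ^+ (1 + 1) = 1)%R by exact: h.
  by rewrite hM dvdn1 => -[<-] /eqP n1; have := cox_label_ge2 hij hM; rewrite n1.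
have cij : cartan i j = (- (z + z^-1))%R by rewrite /cartan (introF eqP hij).
have cji : cartan j i = (- (z + z^-1))%R.
  by rewrite -cij /cartan (introF eqP hij) cox_label_sym eq_sym (introF eqP hij).
apply: symP => f; rewrite sym1; set f' := (((sym_refl i * sym_refl j) ^+ n) f).
have := refl_iter f true n hij; have := refl_iter f false n hij.
rewrite /= -/z -/f' exprVn zn invr1 !mul1r => e2 e1.
have ej : f' j = f j.
  have : ((z - z^-1) * f' j = (z - z^-1) * f j)%R.
    have -> : ((z - z^-1) * f' j = (f' i + z * f' j) - (f' i + z^-1 * f' j))%R by ring.
    by rewrite e1 e2; ring.
  apply: mulfI; rewrite subr_eq0; apply: contra z1 => /eqP h.
  by rewrite expr2 {2}h divff.
have ei : f' i = f i by move: e1; rewrite ej => /addIr.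
have [X [Y hXY]] : exists X Y, forall k, (f' k = f k - X * cartan i k - Y * cartan j k)%R.
  rewrite /f'; elim: n {hM zn f' e1 e2 ei ej} => [|n [X [Y IH]]].
    by exists 0%R, 0%R => k; rewrite expg0 sym1; ring.
  rewrite expgS.
  set g := ((sym_refl i * sym_refl j) ^+ n) f in IH.
  exists (X + refl j g i)%R, (Y + g j)%R => k.
  rewrite 2!symM -/g /= {1}/refl {1}/refl IH; ring.
have := hXY i; have := hXY j; rewrite ei ej cij cji /cartan !eqxx => hj hi.
have c4 : ((z - z^-1) ^+ 2 != 0)%R.
  rewrite sqrf_eq0 subr_eq0; apply: contra z1 => /eqP h.
  by rewrite expr2 {2}h divff.
have X0 : X = 0%R.
  apply: (mulfI c4); rewrite mulr0.
  have a1 : (X * 2 - Y * (z + z^-1) = 0)%R by rewrite -[RHS](subrr (f i)) {2}hi; ring.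
  have a2 : (Y * 2 - X * (z + z^-1) = 0)%R by rewrite -[RHS](subrr (f j)) {2}hj; ring.
  have -> : ((z - z^-1) ^+ 2 * X =
     - (2 * (X * 2 - Y * (z + z^-1)) + (z + z^-1) * (Y * 2 - X * (z + z^-1))))%R by field.
  by rewrite a1 a2; ring.
have Y0 : Y = 0%R.
  move: hj; rewrite X0 => hj.
  have : (Y * 2 = 0)%R by rewrite -[RHS](subrr (f j)) {2}hj; ring.
  by move/eqP; rewrite mulf_eq0 pnatr_eq0 orbF => /eqP.
by apply/funext => k; rewrite hXY X0 Y0; ring.
Qed.

Lemma sym_refl_respects : cox_respects sym_refl.
Proof.
have h i : sym_refl i * sym_refl i = 1 by apply: symP => f; exact: reflK.
by split=> // i j n hij hM; apply/(altp_exp n (h i) (h j)); exact: sym_refl_exp.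
Qed.

Definition tits : cox -> sym (I -> algC) := cox_lift sym_refl.

Lemma titsM : is_hom tits. Proof. exact: cox_liftM sym_refl_respects. Qed.
Lemma titsE i : tits (cgen i) = sym_refl i. Proof. exact: cox_liftE sym_refl_respects _. Qed.

(** The indicator function of [i] is fixed by every reflection other than that of [i], which turns
    its value 1 at [i] into -1. *)
Lemma cgen_parabolic (J : set I) i : gspan (cgen @` J) (cgen i) -> J i.
Proof.
move=> h; apply: contrapT => Ji.
pose f k : algC := (k == i)%:R%R.
have fixJ w : gspan (cgen @` J) w -> tits w f = f.
  elim=> {w} [_ [j Jj <-]||x y _ hx _ hy|x _ hx].
  - rewrite titsE; apply/funext => k; rewrite /= /refl {2}/f.
    by case: eqP => [e|_]; [rewrite -e in Ji|rewrite mul0r subr0].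
  - by rewrite (hom1 titsM).
  - by rewrite titsM symM hy hx.
  - by rewrite (homV titsM); exact: symVE.
have := congr1 (fun g => g i) (fixJ _ h); rewrite titsE /= /refl /cartan /f eqxx mul1r => /eqP.
by rewrite subr_eq addrC -subr_eq subrr eq_sym pnatr_eq0.
Qed.

(** On the indicator function of [i] the eigenform takes the value 1, and k rounds multiply it by
    z^(2k). *)
Lemma cgen_order i j k : i <> j -> (cgen i * cgen j) ^+ k = 1 ->
  k = 0%N \/ exists2 n, M i j = Some n & (n %| k)%N.
Proof.
move=> hij h; have [z0 hz] := zetaP i j.
apply/hz; pose f k : algC := (k == i)%:R%R.
have := refl_iter f true k hij; rewrite /= -!titsE -titsM -(homX titsM) h (hom1 titsM) sym1.
by rewrite /f eqxx eq_sym (introF eqP hij) mulr0 addr0 mulr1 => <-.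
Qed.

End Tits.

Lemma cgen_inj : injective cgen.
Proof.
move=> i j h; apply: contrapT => hij.
have : (cgen i * cgen j) ^+ 1 = 1 by rewrite expg1 h cgenK.
move=> /(cgen_order hij)[//|[n /(cox_label_ge2 hij) n2]].
by rewrite dvdn1 => /eqP n1; move: n2; rewrite n1.
Qed.

End CoxeterGroup.

(** * The reflections crossed by an element, and the exchange property *)

Definition sign := bool.
HB.instance Definition _ := Choice.on sign.
HB.instance Definition _ := isGroup.Build sign addbA addFb addbF addbb addbb.

Section Crossing.
Variables (I : choiceType) (M : coxeter_matrix I).
Local Notation W := (cox M).
Local Notation c := (@cgen I M).
Implicit Types (i j : I) (w t : W).

Definition refl_conj (w t : W) : W := w * t * w^-1.

Lemma refl_conj1 : refl_conj 1 =1 id.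
Proof. by move=> t; rewrite /refl_conj mul1g invg1 mulg1. Qed.
Lemma refl_conjM v w t : refl_conj (v * w) t = refl_conj v (refl_conj w t).
Proof. by rewrite /refl_conj invgM !mulgA. Qed.

(* The reflection crossed by the last applied letter of the alternating word with
   [l.+1] letters whose first applied letter is [i]. *)
Definition alt_refl i j l : W := c i * (c j * c i) ^+ l.

Lemma altpS_refl n i j : altp n.+1 (c i) (c j) = altp n (c i) (c j) * alt_refl i j n.
Proof. exact: altpSr (cgenK _ _) (cgenK _ _). Qed.

Lemma alt_reflS i j l : c i * alt_refl j i l * c i = alt_refl i j l.+1.
Proof.
rewrite /alt_refl -!mulgA; congr (_ * _).
by rewrite mulg_expC mulgA -expgS.
Qed.

Section Finite.
Variables (i j : I) (m : nat) (ij : i <> j) (Mij : M i j = Some m).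

Lemma cgen_expC : (c j * c i) ^+ m = 1.
Proof. by apply: cgen_exp; [exact: nesym|rewrite cox_label_sym]. Qed.

Lemma alt_refl_inj k l : (k < m)%N -> (l < m)%N -> alt_refl i j k = alt_refl i j l -> k = l.
Proof.
suff h k' l' : (k' <= l')%N -> (l' < m)%N -> alt_refl i j k' = alt_refl i j l' -> k' = l'.
  move=> hk hl e; have [kl|lk] := leqP k l; first exact: h.
  by apply/esym/h => //; exact: ltnW.
move=> hkl hl /mulgI e; have : (c j * c i) ^+ (l' - k') = 1.
  by apply: (mulIg ((c j * c i) ^+ k')); rewrite mul1g -expgnDr subnK.
case/(cgen_order (nesym ij)) => [/eqP|[n]].
  by rewrite subn_eq0 => h; apply/eqP; rewrite eqn_leq hkl h.
rewrite cox_label_sym Mij => -[<-] /dvdn_leq h.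
apply/eqP; rewrite eqn_leq hkl leqNgt; apply/negP => kl.
have := h; rewrite subn_gt0 kl => /(_ isT); rewrite leqNgt => /negP; apply.
exact: leq_ltn_trans (leq_subr _ _) hl.
Qed.

(** Both sides of a braid relation cross the same m reflections, in opposite orders. *)
Lemma alt_refl_rev l : (l < m)%N -> alt_refl i j l = alt_refl j i (m.-1 - l).
Proof.
move=> hl; have hm : m.-1 = (l + (m.-1 - l))%N by rewrite subnKC // -ltnS prednK //; case: (m) hl.
rewrite /alt_refl; apply: (mulgI (c j)); rewrite !mulgA cgenK mul1g.
apply: (mulIg ((c j * c i) ^+ (m.-1 - l))).
have jiV k : (c i * c j) ^+ k * (c j * c i) ^+ k = 1.
  have -> : c j * c i = (c i * c j)^-1 by rewrite invgM !cgenV.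
  by rewrite expVgn mulgV.
by rewrite jiV -expgS -expgnDr addSn -hm prednK ?cgen_expC //; case: (m) hl.
Qed.

End Finite.

Variable H : groupType.
Local Notation wr := (wreath H refl_conj1 refl_conjM).

(** Marks with [h] the one reflection that the generator crosses. *)
Definition wrgen i (h : H) : wr := (fun t => if t == c i then h else 1, c i).

(** Letter number l, counted from the right, carries the label [h l]. Varying labels serve the mixed
    relation, where one sigma stands among taus. *)
Fixpoint altw n i j (h : nat -> H) : wr :=
  if n is n'.+1 then altw n' j i (h \o S) * wrgen i (h 0%N) else 1.

Lemma altw2 n i j h : (altw n i j h).2 = altp n (c i) (c j).
Proof. by elim: n i j h => [|n IH] i j h //=; rewrite IH. Qed.

Lemma altw0 n i j h t : (forall l, (l < n)%N -> t <> alt_refl i j l) -> (altw n i j h).1 t = 1.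
Proof.
elim: n i j h t => [|n IH] i j h t ht //=.
have /eqP/negbTE -> : t <> c i by have := ht 0%N isT; rewrite /alt_refl mulg1.
rewrite mulg1 IH // => l hl e; apply: (ht l.+1 hl).
by rewrite -alt_reflS -e /refl_conj cgenV !mulgA cgenK mul1g -mulgA cgenK mulg1.
Qed.

(** A word not longer than the label crosses distinct reflections, so no two labels are multiplied
    together. *)
Lemma altw1 n i j h m l : i <> j -> M i j = Some m -> (n <= m)%N -> (l < n)%N ->
  (altw n i j h).1 (alt_refl i j l) = h l.
Proof.
elim: n i j h l => [|n IH] i j h l ij Mij hn hl //=.
have m0 : (0 < m)%N by exact: leq_trans hn.
case: l hl => [|l] hl.
  rewrite [alt_refl i j 0]mulg1 eqxx altw0 ?mul1g // => l hl' e.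
  have : alt_refl i j l.+1 = alt_refl i j 0.
    by rewrite -alt_reflS -e /refl_conj cgenV /alt_refl mulg1 !mulgA cgenK mul1g cgenK mul1g.
  by move/(alt_refl_inj ij Mij (leq_trans (hl' : (l.+2 <= n.+1)%N) hn) m0).
case: eqP => [e|_].
  have : alt_refl i j l.+1 = alt_refl i j 0 by rewrite e /alt_refl mulg1.
  by move/(alt_refl_inj ij Mij (leq_trans hl hn) m0).
rewrite mulg1 -alt_reflS /refl_conj cgenV !mulgA cgenK mul1g -!mulgA cgenK mulg1 IH //.
- exact: nesym.
- by rewrite cox_label_sym.
- exact: ltnW.
Qed.

(** As the two sides cross the reflections in opposite orders, the labels of one side are those of
    the other read backwards. *)
Lemma altw_swap i j h h' m : i <> j -> M i j = Some m ->
  (forall l, (l < m)%N -> h l = h' (m.-1 - l)%N) -> altw m i j h = altw m j i h'.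
Proof.
move=> ij Mij hh; apply: wrP => [t|]; last by rewrite !altw2; exact: cgen_braid.
have ji := nesym ij; have Mji : M j i = Some m by rewrite cox_label_sym.
have bound l : (l < m)%N -> (m.-1 - l < m)%N.
  by move=> hl; apply: leq_ltn_trans (leq_subr _ _) _; case: (m) hl.
have [[l hl ->]|ht] := pselect (exists2 l, (l < m)%N & t = alt_refl i j l).
  by rewrite (altw1 _ ij Mij) // (alt_refl_rev ij Mij hl) (altw1 _ ji Mji) ?bound // hh.
rewrite !altw0 // => l hl e; apply: ht.
  by exists (m.-1 - l)%N; rewrite ?bound // e (alt_refl_rev ji Mji).
by exists l.
Qed.

Lemma altwSl n i j h :
  altw n.+1 i j h = wrgen (if odd n then j else i) (h n) * altw n i j h.
Proof.
elim: n i j h => [|n IH] i j h; first by rewrite /= mul1g mulg1.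
by rewrite [LHS]/= -/(altw n.+1 j i (h \o S)) IH -mulgA /=; case: (odd n).
Qed.

Lemma altw_const n i j h : altw n i j (fun=> h) = altp n (wrgen i h) (wrgen j h).
Proof.
by elim: n i j => [|n IH] i j //=; rewrite -IH.
Qed.

Lemma eq_altw n i j h h' : (forall l, (l < n)%N -> h l = h' l) -> altw n i j h = altw n i j h'.
Proof.
elim: n i j h h' => [|n IH] i j h h' hh //=.
by rewrite (hh 0%N) // (IH _ _ _ (h' \o S)) // => l hl /=; rewrite hh.
Qed.

Lemma wrgenK i h : h * h = 1 -> wrgen i h * wrgen i h = 1.
Proof.
move=> hh; apply: wrP => [t|] /=; last by rewrite cgenK.
rewrite /refl_conj cgenV; case: (eqVneq t (c i)) => [->|ht].
  by rewrite cgenK mul1g eqxx.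
case: eqP => [e|]; last by rewrite mulg1.
case/eqP: ht; apply: (mulgI (c i)); rewrite cgenK.
by apply: (mulIg (c i)); rewrite e mul1g.
Qed.

Lemma wrgen_respects (p : H) : p * p = 1 -> cox_respects M (wrgen^~ p).
Proof.
move=> pp; split=> [i|i j m ij Mij]; first exact: wrgenK.
by rewrite -!altw_const; exact: altw_swap.
Qed.

End Crossing.

Section Crossed.
Variables (I : choiceType) (M : coxeter_matrix I).
Local Notation wprod := (wprod M).
Local Notation W := (cox M).
Local Notation c := (@cgen I M).
Implicit Types (i j : I) (w t : W).

(* When [t] is a reflection, this says that [w] maps the positive root of [t] to a
   negative root; it is the parity of the number of occurrences of [t] among the
   reflections of a word for [w]. *)
Definition crossed w t : bool :=
  (cox_lift (fun i => wrgen M i (true : sign)) w).1 t.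

Let crossed_hom := cox_liftM (@wrgen_respects I M sign true erefl).
Let crossed_homE := cox_liftE (@wrgen_respects I M sign true erefl).

Lemma cox_lift_wr2 (H : groupType) (p : H) : p * p = 1 ->
  forall w, (cox_lift (fun i => wrgen M i p) w).2 = w.
Proof.
move=> pp; have hf := cox_liftM (wrgen_respects M pp); have hE := cox_liftE (wrgen_respects M pp).
move=> w; have [s ->] := cox_word w.
elim: s => [|i s IH] /=; first by rewrite (hom1 hf).
by rewrite hf /= IH hE.
Qed.

Lemma crossed1 t : crossed 1 t = false.
Proof. by rewrite /crossed (hom1 crossed_hom). Qed.

Lemma crossedM v w t : crossed (v * w) t = crossed v (w * t * w^-1) (+) crossed w t.
Proof. by rewrite /crossed crossed_hom wrME cox_lift_wr2. Qed.

Lemma crossed_gen i t : crossed (c i) t = (t == c i).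
Proof. by rewrite /crossed crossed_homE /=; case: eqP. Qed.

Lemma crossedV w t : crossed w^-1 (w * t * w^-1) = crossed w t.
Proof.
by have := crossedM w^-1 w t; rewrite mulVg crossed1; case: (crossed w t); case: (crossed _ _).
Qed.

Lemma cgen_neq1 i : c i <> 1.
Proof. by move=> h; have := crossed_gen i (c i); rewrite {1}h crossed1 eqxx. Qed.

(** The strong exchange property: some letter of the word crosses [t], and deleting it multiplies
    the product by [t]. The inclusion of letters keeps the result in the same parabolic subgroup. *)
Lemma exchange s t : crossed (wprod s) t ->
  exists2 s', (size s' < size s)%N /\ {subset s' <= s} & wprod s * t = wprod s'.
Proof.
elim: s => [|i s IH] /=; first by rewrite crossed1.
rewrite crossedM crossed_gen; case: (boolP (crossed (wprod s) t)) => [/IH[s' [hs sub] e] _|_].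
  exists (i :: s'); last by rewrite /= -e mulgA.
  by split=> // x; rewrite !inE => /orP[->//|/sub->]; rewrite orbT.
rewrite addbF => /eqP e; exists s; first by split=> // x hx; rewrite inE hx orbT.
by rewrite -mulgA -[wprod s * t](mulgVK (wprod s)) e mulgA cgenK mul1g.
Qed.

Lemma gspan_wprod (J : set I) w : gspan (c @` J) w ->
  exists2 s, (forall i, i \in s -> J i) & w = wprod s.
Proof.
elim=> {w} [_ [i Ji <-]||x y _ [s hs ->] _ [s' hs' ->]|x _ [s hs ->]].
- by exists [:: i] => [k|]; rewrite ?inE /= ?mulg1 // => /eqP->.
- by exists [::].
- by exists (s ++ s'); rewrite ?wprod_cat // => i; rewrite mem_cat => /orP[/hs|/hs'].
- by exists (rev s) => [i|]; [rewrite mem_rev; exact: hs|exact: wprodV].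
Qed.

(** The last letter of a shortest word in [J] is crossed, since otherwise the exchange property
    would shorten the word. *)
Lemma crossed_descent (J : set I) w : gspan (c @` J) w -> w <> 1 -> exists2 i, J i & crossed w (c i).
Proof.
move=> /gspan_wprod[s0 hs0 ew0] w1.
have ex : exists n, `[< exists2 s, size s = n & (forall i, i \in s -> J i) /\ w = wprod s >].
  by exists (size s0); apply/asboolP; exists s0.
case: (ex_minnP ex) => n /asboolP[s sn [hs ew]] hmin.
case: (lastP s) sn hs ew => [|s' i] sn hs ew; first by [].
have Ji : J i by apply: hs; rewrite mem_rcons inE eqxx.
exists i => //; move: ew; rewrite -cats1 wprod_cat /= mulg1 => ew.
have ews : w * c i = wprod s' by rewrite ew -mulgA cgenK mulg1.
apply/negPn/negP => hn.
have h : crossed (wprod s') (c i) by rewrite -ews crossedM crossed_gen eqxx cgenV cgenK mul1g (negbTE hn).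
have [s'' [hsz sub] e] := exchange h.
have : (n <= size s'')%N.
  apply: hmin; apply/asboolP; exists s'' => //; split; last by rewrite ew e.
  by move=> k /sub hk; apply: hs; rewrite mem_rcons inE hk orbT.
by rewrite -sn size_rcons leqNgt ltnW // ltnS ltnW.
Qed.

(** For an element of least length in [P], crossing [t] would make [w * t] shorter. *)
Lemma crossed_min (P : set W) : (exists w, P w) ->
  exists2 w, P w & forall t, P (w * t) -> ~~ crossed w t.
Proof.
move=> [w0 Pw0].
have ex : exists n, `[< exists2 s, size s = n & P (wprod s) >].
  by have [s e] := cox_word w0; exists (size s); apply/asboolP; exists s; rewrite // -e.
case: (ex_minnP ex) => n /asboolP[s sn Ps] hmin; exists (wprod s) => // t Pt.
apply/negP => /exchange[s' [hs _] e].
have : (n <= size s')%N by apply: hmin; apply/asboolP; exists s'; rewrite // -e.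
by rewrite -sn leqNgt hs.
Qed.

End Crossed.

(** * The labelled action on minimal coset representatives *)

Section Dihedral.
Variables (I : choiceType) (M : coxeter_matrix I).
Local Notation W := (cox M).
Local Notation c := (@cgen I M).
Variables (i j : I) (m : nat) (ij : i <> j) (Mij : M i j = Some m).
Implicit Types (d t w : W).

Definition dihedral : set W := gspan (c @` [set i; j]).
Definition dih_refl : set W := range (@alt_refl I M i j).

Lemma dihedral_l : dihedral (c i). Proof. by apply: gspan_in; exists i => //; left. Qed.
Lemma dihedral_r : dihedral (c j). Proof. by apply: gspan_in; exists j => //; right. Qed.

Lemma label_gt0 : (0 < m)%N.
Proof. by have := cox_label_ge2 ij Mij; case: (m). Qed.

(** The exponent m - 1 stands for -1, because [dih_refl] only has natural exponents. *)
Lemma cgen_expM l : (c i * c j) ^+ l = (c j * c i) ^+ (l * m.-1).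
Proof.
apply: (mulIg ((c j * c i) ^+ l)).
have -> : (c i * c j) ^+ l * (c j * c i) ^+ l = 1.
  have -> : c j * c i = (c i * c j)^-1 by rewrite invgM !cgenV.
  by rewrite expVgn mulgV.
rewrite -expgnDr addnC -mulnS prednK ?label_gt0 // mulnC expgnA.
by rewrite (cgen_expC ij Mij) expg1n.
Qed.

Lemma dih_refl_l : dih_refl (c i).
Proof. by exists 0%N => //; rewrite /alt_refl mulg1. Qed.

Lemma dih_reflJl t : dih_refl t -> dih_refl (c i * t * c i).
Proof.
move=> [l _ <-]; exists (l * m.-1)%N => //.
by rewrite /alt_refl -cgen_expM -mulg_expC -!mulgA cgenK mulg1.
Qed.

Lemma dih_reflJr t : dih_refl t -> dih_refl (c j * t * c j).
Proof.
move=> [l _ <-]; exists (l.+2 * m.-1)%N => //.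
rewrite /alt_refl -cgen_expM -mulg_expC; apply: (mulgI (c i)).
by rewrite mulgA cgenK mul1g expgS expgSr !mulgA.
Qed.

Lemma dih_refl_r : dih_refl (c j).
Proof.
exists m.-1 => //; have := alt_refl_rev ij Mij (l := m.-1).
by rewrite subnn /alt_refl mulg1 => -> //; rewrite prednK // label_gt0.
Qed.

Lemma dih_reflJ d t : dihedral d -> dih_refl t -> dih_refl (d * t * d^-1).
Proof.
move=> hd; have hd' : gspan (c @` [set i; j]) d^-1 by exact: gspanV.
suff [h _] : (forall t, dih_refl t -> dih_refl (d * t * d^-1)) /\
    (forall t, dih_refl t -> dih_refl (d^-1 * t * d)) by exact: h.
elim: hd {hd' t} => {d} [_ [k [->|->] <-]||x y _ [hx hx'] _ [hy hy']|x _ [hx hx']].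
- by rewrite cgenV; split=> t; exact: dih_reflJl.
- by rewrite cgenV; split=> t; exact: dih_reflJr.
- by rewrite invg1; split=> t; rewrite mul1g mulg1.
- rewrite invgM; split=> t ht.
    by have := hx _ (hy _ ht); rewrite !mulgA.
  by have := hy' _ (hx' _ ht); rewrite !mulgA.
- by rewrite invgK.
Qed.

Lemma dih_refl_dihedral t : dih_refl t -> dihedral t.
Proof.
move=> [l _ <-]; apply: gspanM dihedral_l _; apply: gspanX.
exact: gspanM dihedral_r dihedral_l.
Qed.

Lemma dih_refl_sq t : dih_refl t -> t * t = 1.
Proof.
move=> [l _ <-]; rewrite /alt_refl -{1}mulg_expC -mulgA [c i * (c i * _)]mulgA cgenK mul1g.
have -> : c j * c i = (c i * c j)^-1 by rewrite invgM !cgenV.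
by rewrite expVgn mulgV.
Qed.

Lemma dih_refl_bound t : dih_refl t -> exists2 l, (l < m)%N & t = alt_refl M i j l.
Proof.
move=> [l _ <-]; exists (l %% m)%N; first by rewrite ltn_mod label_gt0.
rewrite /alt_refl {1}(divn_eq l m) expgnDr mulnC expgnA.
by rewrite (cgen_expC ij Mij) expg1n mul1g.
Qed.

Lemma crossed_dihedral d t : dihedral d -> crossed d t -> dih_refl t.
Proof.
move=> hd; elim: hd t => {d} [_ [k [->|->] <-] t||x y hx IHx hy IHy t|x hx IHx t].
- by rewrite crossed_gen => /eqP->; exact: dih_refl_l.
- by rewrite crossed_gen => /eqP->; exact: dih_refl_r.
- by move=> t; rewrite crossed1.
- rewrite crossedM; case: (boolP (crossed y t)) => [/IHy //|_]; rewrite addbF => /IHx h.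
  have := dih_reflJ (gspanV hy) h; by rewrite invgK !mulgA mulVg mul1g -mulgA mulVg mulg1.
- have -> : crossed x^-1 t = crossed x (x^-1 * t * x).
    by rewrite -(crossedV x) !mulgA mulgV mul1g mulgK.
  by move=> /IHx/(dih_reflJ hx); rewrite !mulgA mulgV mul1g mulgK.
Qed.

Lemma dihedral_min w : exists d v, [/\ dihedral d, w = d * v
  & forall t, dih_refl t -> ~~ crossed v^-1 t].
Proof.
have [|x [d hd dx] hx] := @crossed_min _ M [set x | exists2 d, dihedral d & d * x^-1 = w].
  by exists w^-1, 1; [exact: gspan1|rewrite mul1g invgK].
exists d, x^-1; split=> // t ht; rewrite invgK; apply: hx.
exists (d * t); first exact: gspanM (dih_refl_dihedral ht).
by rewrite invgM -dx -!mulgA; congr (_ * _); rewrite mulgA mulgV mul1g.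
Qed.

(** The usual descent criterion for [w] to be the shortest element of its coset modulo the parabolic
    subgroup of [Y]. *)
Definition coset_min (Y : set I) w := forall y, Y y -> crossed w (c y) = false.

Definition blocked (Y : set I) k w y := Y y /\ w * c y * w^-1 = c k.

(* Two labels can only meet a dihedral subgroup in its two generators: compare with
   an element [v] of minimal length in the dihedral coset of [w]. *)
Lemma two_blocked (Y : set I) w y y' : coset_min Y w -> Y y -> Y y' -> y <> y' ->
  dih_refl (w * c y * w^-1) -> dih_refl (w * c y' * w^-1) ->
  (blocked Y i w y /\ blocked Y j w y') \/ (blocked Y j w y /\ blocked Y i w y').
Proof.
move=> wX Yy Yy' yy' hy hy'.
have [d [v [hd ew hv]]] := dihedral_min w; subst w.
have conjd x : d * v * x * (d * v)^-1 = d * (v * x * v^-1) * d^-1 by rewrite invgM !mulgA.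
have back x : dih_refl (d * v * x * (d * v)^-1) -> dih_refl (v * x * v^-1).
  rewrite conjd => /(dih_reflJ (gspanV hd)).
  by rewrite invgK !mulgA mulVg mul1g -!mulgA mulVg mulg1 !mulgA.
have vX : coset_min Y v.
  move=> x Yx; have := wX x Yx; rewrite crossedM; case e : (crossed v (c x)) => //.
  rewrite addbT => /negbFE /(crossed_dihedral hd) /hv.
  by rewrite crossedV e.
(* The reflection r, the conjugate of [c x] by [v], has a descent [q]. As [v^-1] does not cross
   [c q], in the product [c x * v^-1 = v^-1 * r] it is the letter [c x] that does, whence r is
   [c q]. *)
have key x : Y x -> dih_refl (d * v * c x * (d * v)^-1) ->
    v * c x * v^-1 = c i \/ v * c x * v^-1 = c j.
  move=> Yx /back; set r := v * c x * v^-1 => hr.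
  have r1 : r <> 1.
    move=> r1; apply: (@cgen_neq1 _ M x); apply: (mulgI v); apply: (mulIg v^-1).
    by rewrite -/r r1 mulg1 mulgV.
  have [q hq eq] := crossed_descent (dih_refl_dihedral hr) r1.
  have hcq : dih_refl (c q) by case: hq => ->; [exact: dih_refl_l|exact: dih_refl_r].
  have : crossed (v^-1 * r) (c q).
    rewrite crossedM eq (negbTE (hv _ _)) //; apply: dih_reflJ => //; exact: dih_refl_dihedral.
  have -> : v^-1 * r = c x * v^-1 by rewrite /r !mulgA mulVg mul1g.
  rewrite crossedM (negbTE (hv _ hcq)) addbF crossed_gen invgK => /eqP e.
  have -> : r = c q by rewrite /r -e !mulgA mulgV mul1g mulgK.
  by case: hq => ->; [left|right].
have inj x x' : v * c x * v^-1 = v * c x' * v^-1 -> x = x'.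
  by move=> /mulIg/mulgI/cgen_inj.
have : (v * c y * v^-1 = c i /\ v * c y' * v^-1 = c j) \/
       (v * c y * v^-1 = c j /\ v * c y' * v^-1 = c i).
  case: (key y Yy hy) (key y' Yy' hy') => e [] e'; [|by left|by right|];
  by case: yy'; apply: inj; rewrite e e'.
(* A nontrivial [d] would cross [c i] or [c j], which is the conjugate by [v] of [c y] or [c y'],
   against the minimality of [w]. *)
move=> hij; have d1 : d = 1.
  apply: contrapT => d1; have [q hq eq] := crossed_descent hd d1.
  have no x : Y x -> v * c x * v^-1 = c q -> False.
    by move=> Yx e; have := wX x Yx; rewrite crossedM e eq vX.
  case: hq no {eq} => -> no; case: hij => -[e e'].
  - exact: (no y).
  - exact: (no y').
  - exact: (no y').
  - exact: (no y).
by rewrite d1 mul1g; case: hij => -[e e']; [left|right].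
Qed.

End Dihedral.

Section LabelAction.
Variables (I : choiceType) (M : coxeter_matrix I) (Y : set I).
Variables (G : groupType) (a : I -> G).
Local Notation W := (cox M).
Local Notation c := (@cgen I M).

(* When [c i * w] is not minimal in its coset modulo the parabolic subgroup of [Y],
   it is [w * c y] for some [y] in [Y]; the coset is then fixed, and the letter [y]
   is recorded in [G]. *)
Definition label_act (b : I -> G) (i : I) (p : W * G) : W * G :=
  if pselect (coset_min Y p.1) is left _ then
    if pselect (exists y, blocked Y i p.1 y) is left h then (p.1, b (projT1 (cid h)) * p.2)
    else (c i * p.1, p.2)
  else p.

Lemma label_act_blocked b i w g y : coset_min Y w -> blocked Y i w y ->
  label_act b i (w, g) = (w, b y * g).
Proof.
move=> wX hy; rewrite /label_act /=; case: pselect => // _.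
case: pselect => [h|[]]; last by exists y.
by case: cid => y' /= hy'; congr (_, b _ * _); apply: (@cgen_inj _ M);
  apply: (mulgI w); apply: (mulIg w^-1); rewrite hy.2 hy'.2.
Qed.

Lemma label_act_move b i w g : coset_min Y w -> ~ (exists y, blocked Y i w y) ->
  label_act b i (w, g) = (c i * w, g).
Proof. by move=> wX hy; rewrite /label_act /=; case: pselect => // _; case: pselect. Qed.

Lemma label_act_out b i w g : ~ coset_min Y w -> label_act b i (w, g) = (w, g).
Proof. by move=> wX; rewrite /label_act /=; case: pselect. Qed.

Lemma coset_min_move i w : coset_min Y w -> ~ (exists y, blocked Y i w y) -> coset_min Y (c i * w).
Proof.
move=> wX hy y Yy; rewrite crossedM wX // addbF crossed_gen.
by apply/eqP => e; apply: hy; exists y.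
Qed.

Lemma blocked_move i w y : blocked Y i (c i * w) y <-> blocked Y i w y.
Proof.
rewrite /blocked invgM cgenV; split=> -[Yy e]; split=> //.
  apply: (mulgI (c i)); apply: (mulIg (c i)); transitivity (c i); last by rewrite cgenK mul1g.
  by rewrite -[RHS]e !mulgA.
transitivity (c i * (w * c y * w^-1) * c i); first by rewrite !mulgA.
by rewrite e cgenK mul1g.
Qed.

Lemma label_actK b b' i : (forall y, b' y * b y = 1) -> cancel (label_act b i) (label_act b' i).
Proof.
move=> bb [w g]; have [wX|wX] := pselect (coset_min Y w); last first.
  by rewrite !label_act_out.
have [[y hy]|hy] := pselect (exists y, blocked Y i w y).
  by rewrite !(label_act_blocked _ _ wX hy) mulgA bb mul1g.
rewrite (label_act_move _ _ wX hy) label_act_move.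
- by rewrite mulgA cgenK mul1g.
- exact: coset_min_move.
- by move=> [y /blocked_move h]; apply: hy; exists y.
Qed.

(** The inverse makes the same moves with inverted labels, which is why [label_act] takes the
    labelling as an argument. Pairs that are not minimal stay fixed, so this permutes the whole
    product. *)
Definition label_sym i : sym (W * G) :=
  Sym (label_actK i (fun y => mulVg (a y))) (label_actK i (fun y => mulgV (a y))).

Hypothesis ha : forall i j m, i <> j -> M i j = Some m -> altp m (a i) (a j) = altp m (a j) (a i).

Section Braid.
Variables (i j : I) (m : nat) (ij : i <> j) (Mij : M i j = Some m).

Lemma dihedral_altp n : dihedral i j (altp n (c i) (c j)).
Proof.
suff [] : dihedral i j (altp n (c i) (c j)) /\ dihedral i j (altp n (c j) (c i)) by [].
elim: n => [|n [h1 h2]] /=; first by split; exact: gspan1.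
by split; apply: gspanM => //; [exact: dihedral_l|exact: dihedral_r].
Qed.

Lemma coset_min_free n w g : coset_min Y w ->
  (forall y, Y y -> ~ dih_refl i j (w * c y * w^-1)) ->
  (altp n (label_sym i) (label_sym j)) (w, g) = (altp n (c i) (c j) * w, g)
  /\ coset_min Y (altp n (c i) (c j) * w).
Proof.
move=> wX hY; elim: n => [|n [IH hX]]; first by rewrite sym1 /= mul1g.
rewrite altpSl symM IH; set x := if odd n then j else i.
have -> : (if odd n then label_sym j else label_sym i) = label_sym x by rewrite /x; case: ifP.
have nb : ~ exists y, blocked Y x (altp n (c i) (c j) * w) y.
  move=> [y [Yy e]]; apply: (hY y Yy).
  have hx : dih_refl i j (c x).
    by rewrite /x; case: (odd n); [exact: dih_refl_r ij Mij|exact: dih_refl_l].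
  have := dih_reflJ ij Mij (gspanV (dihedral_altp n)) hx.
  by rewrite -e invgK invgM !mulgA mulVg mul1g -[_ * altp _ _ _]mulgA mulVg mulg1.
rewrite altpSl /= label_act_move //.
have -> : (if odd n then c j else c i) = c x by rewrite /x; case: ifP.
by rewrite !mulgA; split=> //; rewrite -mulgA; exact: coset_min_move.
Qed.

(** Letter number k of the word, counted from the right, is the blocked one: it multiplies the label
    and leaves the coset in place. The factor [alt_refl M i j k] deletes this letter from the
    product. *)
Lemma coset_min_single n k w g y : coset_min Y w -> Y y -> (k < m)%N ->
  w * c y * w^-1 = alt_refl M i j k ->
  (forall y', Y y' -> dih_refl i j (w * c y' * w^-1) -> y' = y) -> (n <= m)%N ->
  let w' := if (n <= k)%N then altp n (c i) (c j) * w
            else altp n (c i) (c j) * alt_refl M i j k * w in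
  (altp n (label_sym i) (label_sym j)) (w, g) = (w', if (n <= k)%N then g else a y * g)
  /\ coset_min Y w'.
Proof.
move=> wX Yy km hyk huniq; elim: n => [|n IH] hn; first by rewrite /= mul1g.
have [IHe hX] := IH (ltnW hn); rewrite (altpSl n (label_sym i)) symM IHe.
set x := if odd n then j else i.
have -> : (if odd n then label_sym j else label_sym i) = label_sym x by rewrite /x; case: ifP.
have xE : (if odd n then c j else c i) = c x by rewrite /x; case: ifP.
set A := altp n (c i) (c j) in hX *.
have AS : altp n.+1 (c i) (c j) = c x * A by rewrite altpSl xE.
have AR : c x = A * alt_refl M i j n * A^-1 by rewrite -altpS_refl AS mulgK.
have hr l : dih_refl i j (alt_refl M i j l) by exists l.
rewrite AS; case: (ltngtP n k) hX => [nk|kn|nk] hX.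
- have nb : ~ exists y', blocked Y x (A * w) y'.
    move=> [y' [Yy' e]].
    have e' : w * c y' * w^-1 = alt_refl M i j n.
      apply: (mulgI A); apply: (mulIg A^-1); rewrite -AR -e invgM !mulgA //.
    have yy : y' = y by apply: huniq => //; rewrite e'.
    by move: nk; rewrite -(alt_refl_inj ij Mij km hn _) ?ltnn // -hyk -yy.
  rewrite [label_sym x _]label_act_move //; split; first by rewrite mulgA.
  by rewrite -mulgA; exact: coset_min_move.
- have rk := dih_refl_sq (hr k).
  have rkV : (alt_refl M i j k)^-1 = alt_refl M i j k by exact: mulg1_eq.
  have nb : ~ exists y', blocked Y x (A * alt_refl M i j k * w) y'.
    move=> [y' [Yy' e]].
    have e' : w * c y' * w^-1 = alt_refl M i j k * alt_refl M i j n * (alt_refl M i j k)^-1.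
      apply: (mulgI (A * alt_refl M i j k)); apply: (mulIg (A * alt_refl M i j k)^-1).
      transitivity (c x); first by rewrite -e !invgM !mulgA.
      rewrite AR; move: rk rkV; generalize (alt_refl M i j k) (alt_refl M i j n) => r s rr rV.
      by rewrite invgM rV !mulgA -[A * r * r]mulgA rr mulg1 -[_ * r * r]mulgA rr mulg1.
    have yy : y' = y.
      by apply: huniq => //; rewrite e'; exact: (dih_reflJ ij Mij (dih_refl_dihedral (hr k)) (hr n)).
    have : alt_refl M i j k = alt_refl M i j n.
      move: e'; rewrite yy hyk rkV => e'; apply: (mulgI (alt_refl M i j k)).
      by apply: (mulIg (alt_refl M i j k)); rewrite -e' rk mul1g.
    by move/(alt_refl_inj ij Mij km hn) => e2; move: kn; rewrite e2 ltnn.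
  rewrite [label_sym x _]label_act_move //; split; first by rewrite !mulgA.
  by rewrite -[c x * A * _]mulgA -[c x * _ * w]mulgA; exact: coset_min_move hX nb.
- subst k; have hb : blocked Y x (A * w) y.
    by split=> //; rewrite invgM AR -hyk !mulgA.
  rewrite [label_sym x _](label_act_blocked _ _ hX hb).
  have rn := dih_refl_sq (hr n).
  have -> : c x * A * alt_refl M i j n = A.
    by rewrite AR mulgVK -mulgA rn mulg1.
  by [].
Qed.

End Braid.

(** The cases count the letters of [Y] that [w] conjugates into the dihedral reflections. None: both
    words act by left multiplication. One: the two words meet it at mirror positions and record it
    once. Two: by [two_blocked] the coset does not move, and the recorded labels satisfy the braid
    relation [ha]. *)
Lemma label_sym_braid i j m : i <> j -> M i j = Some m ->
  altp m (label_sym i) (label_sym j) = altp m (label_sym j) (label_sym i).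
Proof.
move=> ij Mij; have ji := nesym ij; have Mji : M j i = Some m by rewrite cox_label_sym.
have hrev (t : W) : dih_refl i j t -> dih_refl j i t.
  move=> /(@dih_refl_bound _ M _ _ _ ij Mij t)[l hl ->].
  by rewrite (alt_refl_rev ij Mij) //; exists (m.-1 - l)%N.
have hrev' (t : W) : dih_refl j i t -> dih_refl i j t.
  move=> /(@dih_refl_bound _ M _ _ _ ji Mji t)[l hl ->].
  by rewrite (alt_refl_rev ji Mji) //; exists (m.-1 - l)%N.
apply: symP => -[w g]; have [wX|wX] := pselect (coset_min Y w); last first.
  have out n k l : altp n (label_sym k) (label_sym l) (w, g) = (w, g).
    by elim: n k l => [|n IH] k l //=; rewrite label_act_out.
  by rewrite !out.
have [[y Yy hy]|no] := pselect (exists2 y, Y y & dih_refl i j (w * c y * w^-1)); last first.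
  have [-> _] := coset_min_free ij Mij m g wX (fun y Yy h => no (ex_intro2 _ _ y Yy h)).
  have [-> _] := coset_min_free ji Mji m g wX (fun y Yy h => no (ex_intro2 _ _ y Yy (hrev' _ h))).
  by rewrite (cgen_braid ij Mij).
have [[y' Yy' [hy' yy']]|uniq_y] :=
    pselect (exists2 y', Y y' & dih_refl i j (w * c y' * w^-1) /\ y <> y').
  have both u v : blocked Y i w u -> blocked Y j w v ->
      altp m (label_sym i) (label_sym j) (w, g) = altp m (label_sym j) (label_sym i) (w, g).
    move=> hu hv.
    have uv : u <> v.
      move=> uv; apply: ij; apply: (@cgen_inj _ M); by rewrite -hu.2 -hv.2 uv.
    (* The label is the order of the product of the two generators, which conjugation by [w]
       preserves. *)
    have Muv : M u v = Some m.
      have cE : c u * c v = w^-1 * (c i * c j) * w.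
        rewrite -hu.2 -hv.2 !mulgA mulVg mul1g -!mulgA; congr (_ * _).
        by rewrite mulVg mulg1 mulgA mulVg mul1g.
      have pE n : (c u * c v) ^+ n = w^-1 * (c i * c j) ^+ n * w.
        elim: n => [|n IH]; first by rewrite !expg0 mulg1 mulVg.
        by rewrite !expgS IH cE !mulgA mulgK.
      have m0 := label_gt0 ij Mij.
      have : (c u * c v) ^+ m = 1 by rewrite pE (cgen_exp ij Mij) mulg1 mulVg.
      case/(cgen_order uv) => [m00|[n Mn nm]]; first by move: m0; rewrite m00.
      have : (c i * c j) ^+ n = 1.
        apply: (mulgI w^-1); apply: (mulIg w); rewrite -pE (cgen_exp uv Mn).
        by rewrite mulg1 mulVg.
      case/(cgen_order ij) => [n0|[m']].
        by move: nm; rewrite n0 dvd0n => /eqP m00; move: m0; rewrite m00.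
      rewrite Mij => -[<-] mn; rewrite Mn; congr Some; apply/eqP; by rewrite eqn_dvd nm.
    have run n : altp n (label_sym i) (label_sym j) (w, g) = (w, altp n (a u) (a v) * g)
             /\ altp n (label_sym j) (label_sym i) (w, g) = (w, altp n (a v) (a u) * g).
      elim: n => [|n [IH1 IH2]]; first by rewrite !sym1 !mul1g.
      rewrite !altpSl !symM IH1 IH2; case: (odd n).
        by rewrite /= (label_act_blocked _ _ wX hv) (label_act_blocked _ _ wX hu) !mulgA.
      by rewrite /= (label_act_blocked _ _ wX hv) (label_act_blocked _ _ wX hu) !mulgA.
    by have [-> ->] := run m; rewrite (ha uv Muv).
  by have [[h1 h2]|[h1 h2]] := two_blocked ij Mij wX Yy Yy' yy' hy hy'; [exact: (both y y')|exact: (both y' y)].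
have hu y' : Y y' -> dih_refl i j (w * c y' * w^-1) -> y' = y.
  move=> Yy' hy'; apply: contrapT => yy'; apply: uniq_y; exists y' => //; split=> //; exact: nesym.
have [k km ek] := dih_refl_bound ij Mij hy.
have ek' : w * c y * w^-1 = alt_refl M j i (m.-1 - k) by rewrite ek (alt_refl_rev ij Mij).
have km' : (m.-1 - k < m)%N.
  by apply: leq_ltn_trans (leq_subr _ _) _; rewrite prednK // (label_gt0 ij Mij).
have [-> _] := coset_min_single ij Mij g wX Yy km ek hu (leqnn m).
have [-> _] := coset_min_single ji Mji g wX Yy km' ek' (fun y' Yy' h => hu y' Yy' (hrev' _ h)) (leqnn m).
have -> : (m <= k)%N = false by rewrite leqNgt km.
have -> : (m <= m.-1 - k)%N = false by rewrite leqNgt km'.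
by congr (_ * _ * _, _); [exact: cgen_braid|exact: alt_refl_rev].
Qed.

End LabelAction.

(** * Virtual Artin groups and their kernel onto the Coxeter group *)

Section VirtualArtinGroup.
Variables (S : countType) (M : coxeter_matrix S).
Local Notation W := (cox M).
Local Notation c := (@cgen S M).
Local Notation G := (virtual_artin M).
Local Notation sg := (@sigma S M).
Local Notation ta := (@tau S M).

Record va_respects (H : groupType) (f g : S -> H) : Prop := VaRespects {
  va_sigma : forall s t n, s <> t -> M s t = Some n -> altp n (f s) (f t) = altp n (f t) (f s);
  va_tau : forall s t n, s <> t -> M s t = Some n -> altp n (g s) (g t) = altp n (g t) (g s);
  va_tauK : forall s, g s * g s = 1;
  va_mixed : forall s t n, s <> t -> M s t = Some n ->
    altp n.-1 (g s) (g t) * f t = f (if odd n then s else t) * altp n.-1 (g s) (g t) }.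

Definition va_gens (H : Type) (f g : S -> H) (x : S + S) : H :=
  match x with inl s => f s | inr s => g s end.

Definition va_lift (H : groupType) (f g : S -> H) : G -> H :=
  @pg_lift _ (va_rel M) H (va_gens f g).

Section Lift.
Variables (H : groupType) (f g : S -> H) (hfg : va_respects f g).

Lemma va_respectsP : respects (va_rel M) (va_gens f g).
Proof.
move=> u v [s t n st hM|s t n st hM|s|s t n st hM].
- by rewrite !eval_alt; exact: va_sigma hfg _ _ _ st hM.
- by rewrite !eval_alt; exact: va_tau hfg _ _ _ st hM.
- by rewrite /= mulg1; exact: va_tauK hfg s.
- by rewrite -cats1 eval_cat /= mulg1 !eval_alt; exact: va_mixed hfg _ _ _ st hM.
Qed.

Lemma va_liftM : is_hom (va_lift f g). Proof. exact: pg_liftM va_respectsP. Qed.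
Lemma va_lift_sigma s : va_lift f g (sg s) = f s.
Proof. exact: pg_liftE va_respectsP (inl s). Qed.
Lemma va_lift_tau s : va_lift f g (ta s) = g s.
Proof. exact: pg_liftE va_respectsP (inr s). Qed.
End Lift.

Lemma va_ind (P : G -> Prop) :
  P 1 -> (forall x y, P x -> P y -> P (x * y)) -> (forall x, P x -> P x^-1) ->
  (forall s, P (sg s)) -> (forall s, P (ta s)) -> forall x, P x.
Proof. by move=> h1 hM hV hs ht; apply: pg_ind => // -[]. Qed.

Lemma class_alt (T : S -> S + S) n s t :
  class_of_word (va_rel M) (alt_word n (letter (T s)) (letter (T t))) =
  altp n (class_of_word (va_rel M) [:: letter (T s)]) (class_of_word (va_rel M) [:: letter (T t)]) :> G.
Proof. by elim: n s t => [|n IH] s t //=; rewrite -cats1 pg_mulE IH. Qed.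

Lemma va_id_respects : va_respects sg ta.
Proof.
split=> [s t n st hM|s t n st hM|s|s t n st hM].
- rewrite -!(class_alt inl); apply/class_of_wordP/word_cong_rel; exact: VA1.
- rewrite -!(class_alt inr); apply/class_of_wordP/word_cong_rel; exact: VA2.
- rewrite -pg_mulE; apply/class_of_wordP/word_cong_rel; exact: VA2_involution.
- rewrite -!(class_alt inr) -!pg_mulE cats1.
  by apply/class_of_wordP/word_cong_rel; exact: VA3.
Qed.

Lemma tau_respects : cox_respects M ta.
Proof. by case: va_id_respects. Qed.

Lemma altp_mixed s t n : s <> t -> M s t = Some n ->
  altp n.-1 (c s) (c t) * c t = c (if odd n then s else t) * altp n.-1 (c s) (c t).
Proof.
move=> st hM; have := cgen_braid st hM; have n0 := label_gt0 st hM.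
rewrite -(prednK n0) altpSl /= -/(altp n.-1.+1 _ _) => <-.
by congr (_ * _); case: (odd _).
Qed.

Lemma cox_proj_respects : va_respects (fun=> 1 : W) c.
Proof.
split=> [//|s t n st hM|s|s t n st hM]; first exact: cgen_braid st hM.
  exact: cgenK.
by rewrite mulg1 mul1g.
Qed.

Lemma cox_total_respects : va_respects c c.
Proof.
by split=> *; [exact: cgen_braid|exact: cgen_braid|exact: cgenK|exact: altp_mixed].
Qed.

Definition cox_emb : W -> G := cox_lift ta.
Definition cox_proj : G -> W := va_lift (fun=> 1) c.
(** Sends a root to its reflection, whereas [cox_proj] kills it; orders of products of reflections
    are read off through this map. *)
Definition cox_total : G -> W := va_lift c c.

Local Notation "'iot'" := cox_emb.
Local Notation pr := cox_proj.
Local Notation tot := cox_total.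

Lemma cox_embM : is_hom iot. Proof. exact: cox_liftM tau_respects. Qed.
Lemma cox_embE s : iot (c s) = ta s. Proof. exact: cox_liftE tau_respects s. Qed.
Lemma cox_projM : is_hom pr. Proof. exact: va_liftM cox_proj_respects. Qed.
Lemma cox_totalM : is_hom tot. Proof. exact: va_liftM cox_total_respects. Qed.
Lemma cox_proj_sigma s : pr (sg s) = 1. Proof. exact: va_lift_sigma cox_proj_respects s. Qed.
Lemma cox_proj_tau s : pr (ta s) = c s. Proof. exact: va_lift_tau cox_proj_respects s. Qed.
Lemma cox_total_sigma s : tot (sg s) = c s. Proof. exact: va_lift_sigma cox_total_respects s. Qed.
Lemma cox_total_tau s : tot (ta s) = c s. Proof. exact: va_lift_tau cox_total_respects s. Qed.

Lemma cox_gen_ind (P : W -> Prop) : P 1 -> (forall s w, P w -> P (c s * w)) -> forall w, P w.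
Proof.
move=> h1 hM w; have [s ->] := cox_word w.
by elim: s => //= s l IH; exact: hM.
Qed.

Lemma cox_embK : cancel iot pr.
Proof.
elim/cox_gen_ind => [|s w IH]; first by rewrite (hom1 cox_embM) (hom1 cox_projM).
by rewrite cox_embM cox_projM IH cox_embE cox_proj_tau.
Qed.

Lemma cox_emb_total : cancel iot tot.
Proof.
elim/cox_gen_ind => [|s w IH]; first by rewrite (hom1 cox_embM) (hom1 cox_totalM).
by rewrite cox_embM cox_totalM IH cox_embE cox_total_tau.
Qed.

Definition cj (u : W) (g : G) : G := iot u * g * (iot u)^-1.

Lemma cjM u : is_hom (cj u).
Proof. by move=> x y; rewrite /cj -!mulgA mulKg. Qed.
Lemma cj1 : cj 1 =1 id.
Proof. by move=> x; rewrite /cj (hom1 cox_embM) mul1g invg1 mulg1. Qed.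
Lemma cj_cj u v g : cj u (cj v g) = cj (u * v) g.
Proof. by rewrite /cj cox_embM invgM !mulgA. Qed.
Lemma cjK u : cancel (cj u) (cj u^-1).
Proof. by move=> g; rewrite cj_cj mulVg cj1. Qed.
Lemma cjVK u : cancel (cj u^-1) (cj u).
Proof. by move=> g; rewrite cj_cj mulgV cj1. Qed.
Lemma cj_inj u : injective (cj u). Proof. exact: can_inj (cjK u). Qed.
Lemma cj_proj u g : pr (cj u g) = u * pr g * u^-1.
Proof. by rewrite /cj !cox_projM (homV cox_projM) cox_embK. Qed.
Lemma cj_total u g : tot (cj u g) = u * tot g * u^-1.
Proof. by rewrite /cj !cox_totalM (homV cox_totalM) cox_emb_total. Qed.
Lemma cj_fixed w g : pr g = 1 -> pr (cj w g) = 1.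
Proof. by move=> h; rewrite cj_proj h mulg1 mulgV. Qed.

Lemma cj_alt s t n : s <> t -> M s t = Some n ->
  cj (altp n.-1 (c s) (c t)) (sg t) = sg (if odd n then s else t).
Proof.
move=> st hM; rewrite /cj (altp_hom _ _ _ cox_embM) !cox_embE.
by rewrite (va_mixed va_id_respects st hM) mulgK.
Qed.

Definition va_roots : set G := [set g | exists u s, g = cj u (sg s)].

Lemma sigma_root s : va_roots (sg s). Proof. by exists 1, s; rewrite cj1. Qed.
Lemma cj_root u g : va_roots g -> va_roots (cj u g).
Proof. by move=> [v [s ->]]; exists (u * v), s; rewrite cj_cj. Qed.
Lemma root_proj g : va_roots g -> pr g = 1.
Proof. by move=> [v [s ->]]; rewrite cj_fixed // cox_proj_sigma. Qed.

Lemma gspan_roots_cj u g : gspan va_roots g -> gspan va_roots (cj u g).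
Proof. by apply: gspan_hom (cjM u) _ _ => x /(cj_root u); exact: gspan_in. Qed.

Lemma gspan_proj (X : set G) g : X `<=` va_roots -> gspan X g -> pr g = 1.
Proof.
move=> hX; elim=> {g} [g /hX /root_proj //||x y _ hx _ hy|x _ hx].
- exact: hom1 cox_projM.
- by rewrite cox_projM hx hy mulg1.
- by rewrite (homV cox_projM) hx invg1.
Qed.

Lemma proj_decomp g : gspan va_roots (g * (iot (pr g))^-1).
Proof.
elim/va_ind: g => [|x y hx hy|x hx|s|s].
- by rewrite (hom1 cox_projM) (hom1 cox_embM) mulgV; exact: gspan1.
- have := gspanM hx (gspan_roots_cj (pr x) hy).
  by rewrite /cj cox_projM cox_embM invgM !mulgA mulgVK.
- have := gspan_roots_cj (pr x)^-1 (gspanV hx).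
  by rewrite /cj (homV cox_projM) (homV cox_embM) invgM !invgK !mulgA mulVg mul1g.
- by rewrite cox_proj_sigma (hom1 cox_embM) invg1 mulg1; apply/gspan_in/sigma_root.
- by rewrite cox_proj_tau cox_embE mulgV; exact: gspan1.
Qed.

Lemma proj_ker g : pr g = 1 <-> gspan va_roots g.
Proof.
split; last exact: gspan_proj.
by move=> h; have := proj_decomp g; rewrite h (hom1 cox_embM) invg1 mulg1.
Qed.

(* The universal property of the kernel of [cox_proj]: it is presented by the braid
   relations between roots. It is read off a morphism to a wreath product, so that
   neither a presentation of the kernel nor a semidirect product is needed. *)
Section Universal.
Variables (H : groupType) (D : G -> H).
Hypothesis hD : forall u s t n, s <> t -> M s t = Some n ->
  altp n (D (cj u (sg s))) (D (cj u (sg t))) = altp n (D (cj u (sg t))) (D (cj u (sg s))).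

Let left_act (u x : W) : W := u * x.
Let left_act1 : left_act 1 =1 id. Proof. by move=> x; exact: mul1g. Qed.
Let left_actM u v x : left_act (u * v) x = left_act u (left_act v x).
Proof. by rewrite /left_act mulgA. Qed.
Local Notation wr := (wreath H left_act1 left_actM).

(** The coordinate at [x] is the value of [D] at the root moved by [x^-1]. Since [wta u] shifts
    coordinates by [u], the mixed relation becomes an equality between moved roots. *)
Let wsig s : wr := (fun x => D (cj x^-1 (sg s)), 1).
Let wta w : wr := (fun=> 1, w).

Let wtaM : is_hom wta.
Proof. by move=> u v; apply: wrP => //= x; rewrite mulg1. Qed.

Let wsig_alt n s t : altp n (wsig s) (wsig t) =
  (fun x => altp n (D (cj x^-1 (sg s))) (D (cj x^-1 (sg t))), 1) :> wr.
Proof.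
elim: n s t => [|n IH] s t //=; rewrite IH; apply: wrP => [x|] /=; last by rewrite mulg1.
by rewrite left_act1.
Qed.

Let wr_respects : va_respects wsig (wta \o c).
Proof.
split=> [s t n st hM|s t n st hM|s|s t n st hM] /=.
- by rewrite !wsig_alt; apply: wrP => //= x; exact: hD.
- by rewrite -!(altp_hom _ _ _ wtaM) (cgen_braid st hM).
- by rewrite -wtaM cgenK.
- rewrite -!(altp_hom _ _ _ wtaM); apply: wrP => [x|] /=; last by rewrite mulg1 mul1g.
  rewrite mul1g mulg1 -(cj_alt st hM) cj_cj; congr (D (cj _ _)).
  by rewrite /left_act invgM mulgVK.
Qed.

Let Theta : G -> wr := va_lift wsig (wta \o c).

(** The coordinate at 1 is multiplicative when the right factor lies in the kernel of [cox_proj], as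
    coordinates are then not shifted. *)
Definition fiber_hom (g : G) : H := (Theta g).1 1.

Let ThetaM : is_hom Theta := va_liftM wr_respects.

Let Theta2 g : (Theta g).2 = pr g.
Proof.
elim/va_ind: g => [|x y hx hy|x hx|s|s].
- by rewrite (hom1 ThetaM) (hom1 cox_projM).
- by rewrite ThetaM cox_projM /= hx hy.
- by rewrite (homV ThetaM) (homV cox_projM) /= hx.
- by rewrite /Theta va_lift_sigma // cox_proj_sigma.
- by rewrite /Theta va_lift_tau // cox_proj_tau.
Qed.

Lemma fiber_homM f g : pr g = 1 -> fiber_hom (f * g) = fiber_hom f * fiber_hom g.
Proof. by move=> hg; rewrite /fiber_hom ThetaM /= Theta2 hg left_act1. Qed.

Lemma fiber_hom1 : fiber_hom 1 = 1.
Proof. by rewrite /fiber_hom (hom1 ThetaM). Qed.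

Lemma fiber_homV g : pr g = 1 -> fiber_hom g^-1 = (fiber_hom g)^-1.
Proof.
by move=> hg; apply: (mulIg (fiber_hom g)); rewrite -fiber_homM // !mulVg fiber_hom1.
Qed.

Lemma fiber_homE g : va_roots g -> fiber_hom g = D g.
Proof.
move=> [u [s ->]]; rewrite /fiber_hom /cj !ThetaM (homV ThetaM).
have Tu w : Theta (iot w) = wta w.
  elim/cox_gen_ind: w => [|t w IH]; first by rewrite (hom1 cox_embM) (hom1 ThetaM) (hom1 wtaM).
  by rewrite cox_embM ThetaM IH cox_embE /Theta va_lift_tau // wtaM.
rewrite Tu /Theta va_lift_sigma //= mul1g invg1 mulg1.
by rewrite /left_act !mulg1 invgK.
Qed.

End Universal.

Definition root_pair (g h : G) n := exists u s t,
  [/\ s <> t, M s t = Some n, g = cj u (sg s) & h = cj u (sg t)].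

Lemma root_pair_sym g h n : root_pair g h n -> root_pair h g n.
Proof. by move=> [u [s [t [st hM -> ->]]]]; exists u, t, s; split=> //; [exact: nesym|rewrite cox_label_sym]. Qed.

(** The label is recovered from the two reflections, whatever [u], [s] and [t] present the pair; so
    [root_label] does not depend on a choice. *)
Lemma root_pair_order g h n k : root_pair g h n -> (tot g * tot h) ^+ k = 1 <-> (n %| k)%N.
Proof.
move=> [u [s [t [st hM -> ->]]]]; rewrite !cj_total !cox_total_sigma.
have -> : u * c s * u^-1 * (u * c t * u^-1) = (c s * c t) ^ u^-1.
  by rewrite /conjg invgK !mulgA mulgVK.
rewrite -conjXg; split=> [/eqP|/dvdnP[q ->]].
  rewrite conjg_eq1 => /eqP /(cgen_order st)[-> |[m]]; first exact: dvdn0.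
  by rewrite hM => -[<-].
by rewrite mulnC expgnA (cgen_exp st hM) expg1n conj1g.
Qed.

Lemma root_pair_inj g h n n' : root_pair g h n -> root_pair g h n' -> n = n'.
Proof.
move=> hn hn'; apply/eqP; rewrite eqn_dvd; apply/andP.
by split; [apply/(root_pair_order _ hn)/(root_pair_order _ hn')|apply/(root_pair_order _ hn')/(root_pair_order _ hn)].
Qed.

Lemma root_pair_ge2 g h n : root_pair g h n -> (2 <= n)%N.
Proof. by move=> [u [s [t [st hM _ _]]]]; exact: cox_label_ge2 st hM. Qed.

Lemma root_pair_neq g h n : root_pair g h n -> g <> h.
Proof.
move=> [u [s [t [st _ -> ->]]]] /cj_inj /(congr1 tot).
by rewrite !cox_total_sigma => /cgen_inj.
Qed.

Lemma root_pair_braid g h n : root_pair g h n -> altp n g h = altp n h g.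
Proof.
move=> [u [s [t [st hM -> ->]]]]; rewrite -!(altp_hom _ _ _ (cjM u)).
by rewrite (va_sigma va_id_respects st hM).
Qed.

(* A Coxeter matrix on all of [G]: an element which is not a root gets the label
   infinity with every other element. *)
Definition root_label (g h : G) : option nat :=
  if g == h then Some 1%N else
  if pselect (exists n, root_pair g h n) is left e then Some (projT1 (cid e)) else None.

Lemma root_labelE g h n : root_pair g h n -> root_label g h = Some n.
Proof.
move=> hn; rewrite /root_label (introF eqP (root_pair_neq hn)).
case: pselect => [e|]; last by case; exists n.
by case: cid => n' /= hn'; rewrite (root_pair_inj hn hn').
Qed.

Lemma root_labelP g h n : g <> h -> root_label g h = Some n -> root_pair g h n.
Proof.
move=> gh; rewrite /root_label (introF eqP gh); case: pselect => // e [<-].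
by case: cid.
Qed.

Lemma root_label_sym g h : root_label g h = root_label h g.
Proof.
have [->//|gh] := pselect (g = h); have hg := nesym gh.
case e : (root_label g h) => [n|].
  by rewrite (root_labelE (root_pair_sym (root_labelP gh e))).
case e' : (root_label h g) => [n|//].
by rewrite (root_labelE (root_pair_sym (root_labelP hg e'))) in e.
Qed.

Lemma root_label_diag g : root_label g g = Some 1%N.
Proof. by rewrite /root_label eqxx. Qed.

Lemma root_label_ge2 g h n : g <> h -> root_label g h = Some n -> (2 <= n)%N.
Proof. by move=> gh /(root_labelP gh)/root_pair_ge2. Qed.

Definition root_matrix : coxeter_matrix G :=
  CoxeterMatrix root_label_sym root_label_diag root_label_ge2.

(* Along a word in [Y0] starting from the trivial coset, the labelled action only
   records letters of [Y0] other than [b], while a word in [va_roots `\ b] is recorded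
   entirely. *)
Lemma parabolic_inter (b : G) (Y0 : set G) f : Y0 `<=` va_roots ->
  gspan (va_roots `\ b) f -> gspan Y0 f -> gspan (Y0 `\ b) f.
Proof.
move=> Y0r hf hf0; set Y := va_roots `\ b in hf.
have Yr : Y `<=` va_roots by move=> x [].
have idb g h n : g <> h -> root_matrix g h = Some n -> altp n g h = altp n h g.
  by move=> gh /(root_labelP gh)/root_pair_braid.
(* With [id] as labelling each root is recorded as itself, so the second component multiplies out in
   [G]. *)
pose D (g : G) := @label_sym G root_matrix Y G id g.
have hD u s t n : s <> t -> M s t = Some n ->
    altp n (D (cj u (sg s))) (D (cj u (sg t))) = altp n (D (cj u (sg t))) (D (cj u (sg s))).
  move=> st hM; have hr : root_pair (cj u (sg s)) (cj u (sg t)) n by exists u, s, t.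
  exact: (label_sym_braid Y idb (root_pair_neq hr) (root_labelE hr)).
pose th := fiber_hom D.
have min1 : coset_min Y (1 : cox root_matrix) by move=> y _; rewrite crossed1.
have fix1 x : gspan Y x -> forall g, th x (1, g) = (1, x * g).
  elim=> {x} [x Yx g||x y hx IHx hy IHy g|x hx IHx g].
  - rewrite /th fiber_homE //; last exact: Yr.
    by rewrite /D /= (@label_act_blocked _ _ _ _ _ _ _ _ x) //; split=> //; rewrite mul1g invg1 mulg1.
  - by move=> g; rewrite /th fiber_hom1 // mul1g.
  - by rewrite /th fiber_homM ?(gspan_proj Yr hy) // symM IHy IHx mulgA.
  - rewrite /th fiber_homV ?(gspan_proj Yr hx) //.
    by apply: symVE; rewrite IHx mulVKg.
pose good (x : sym (cox root_matrix * G)) := forall w g, gspan (@cgen _ root_matrix @` Y0) w ->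
  exists w' h, [/\ x (w, g) = (w', h * g), gspan (@cgen _ root_matrix @` Y0) w' & gspan (Y0 `\ b) h].
have step (a : G -> G) y : (forall y, gspan (Y0 `\ b) y -> gspan (Y0 `\ b) (a y)) -> Y0 y ->
    forall w g, gspan (@cgen _ root_matrix @` Y0) w -> exists w' h,
      [/\ @label_act _ root_matrix Y G a y (w, g) = (w', h * g),
          gspan (@cgen _ root_matrix @` Y0) w' & gspan (Y0 `\ b) h].
  move=> ha Yy w g hw.
  have cy : gspan (@cgen _ root_matrix @` Y0) (cgen root_matrix y) by apply: gspan_in; exists y.
  have [wX|wX] := pselect (coset_min Y w); last first.
    by exists w, 1; rewrite label_act_out // mul1g; split=> //; exact: gspan1.
  have [[y' hy']|hy] := pselect (exists y', blocked Y y w y').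
    exists w, (a y'); rewrite (label_act_blocked _ _ wX hy'); split=> //.
    apply: ha; apply: gspan_in; case: hy' => -[_ yb] e; split=> //.
    (* The recorded letter is conjugate to a letter of [Y0] inside the parabolic subgroup of [Y0],
       which contains no generator outside [Y0]. *)
    apply: (@cgen_parabolic _ root_matrix).
    have -> : cgen root_matrix y' = w^-1 * cgen root_matrix y * w.
      by rewrite -e !mulgA mulVg mul1g mulgVK.
    by apply: gspanM => //; apply: gspanM => //; exact: gspanV.
  exists (cgen root_matrix y * w), 1; rewrite label_act_move // mul1g; split=> //.
    exact: gspanM.
  exact: gspan1.
have good2 x : gspan Y0 x -> good (th x) /\ good (th x)^-1.
  elim=> {x} [x Yx||x y hx [gx gx'] hy [gy gy']|x hx [gx gx']].
  - rewrite /th fiber_homE //; last exact: Y0r.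
    split=> w g hw /=; first exact: (step id).
    by apply: step => // y; exact: gspanV.
  - rewrite /th fiber_hom1 // invg1; split=> w g hw; exists w, 1;
    by rewrite sym1 mul1g; split=> //; exact: gspan1.
  - have -> : th (x * y) = th x * th y by rewrite /th fiber_homM // (gspan_proj Y0r hy).
    have comp u v : good u -> good v -> good (u * v).
      move=> gu gv w g /(gv _ g)[w' [h [e hw' hh]]]; have [w'' [h' [e' hw'' hh']]] := gu _ (h * g) hw'.
      by exists w'', (h' * h); rewrite symM e e' mulgA; split=> //; exact: gspanM.
    by rewrite invgM; split; exact: comp.
  - by rewrite /th fiber_homV ?(gspan_proj Y0r hx) // invgK.
(* At the base point [(1, 1)] the first reading of [f] records [f] itself, and the second an element
   generated by [Y0] without [b]. *)
have [w' [h [e _ hh]]] := (good2 f hf0).1 1 1 gspan1.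
by move: e; rewrite fix1 // !mulg1 => -[_ ->].
Qed.

End VirtualArtinGroup.

(** * Opposite roots *)

Section NegativeRoots.
Variables (S : countType) (M : coxeter_matrix S).
Local Notation W := (cox M).
Local Notation c := (@cgen S M).
Local Notation G := (virtual_artin M).
Local Notation sg := (@sigma S M).
Local Notation ta := (@tau S M).
Local Notation iot := (@cox_emb S M).
Local Notation pr := (@cox_proj S M).
Local Notation tot := (@cox_total S M).
Local Notation root := (@va_roots S M).

Let o1 : 'I_3 := Ordinal (isT : 1 < 3).
Let o2 : 'I_3 := Ordinal (isT : 2 < 3).
Let H : groupType := {perm 'I_3}.
Let p : H := tperm ord0 o1.
Let q : H := tperm o1 o2.

Let pp : p * p = 1. Proof. exact: tperm2. Qed.

Let pq : p * q <> q * p.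
Proof.
move/(congr1 (fun s : {perm 'I_3} => s ord0)); rewrite !permM tpermL tpermL.
by rewrite (@tpermD _ o1 o2 ord0) // tpermL => /(congr1 val).
Qed.

(* Each crossing of a reflection is recorded by [p] for a tau and by [q] for a
   sigma; as [p] and [q] do not commute, this separates opposite roots. *)
Let cross_respects : va_respects M (fun s => wrgen M s q) (fun s => wrgen M s p).
Proof.
split=> [s t n st hM|s t n st hM|s|s t n st hM].
- by rewrite -!altw_const; exact: altw_swap.
- by rewrite -!altw_const; exact: altw_swap.
- exact: wrgenK.
- have ts := nesym st; have hM' : M t s = Some n by rewrite cox_label_sym.
  have n0 := label_gt0 st hM; have nE : n.-1.+1 = n by rewrite prednK.
  (* The sigma is the rightmost letter, number 0, on one side of the mixed relation and the leftmost
     one, number n - 1, on the other, as the reversal in [altw_swap] demands. *)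
  pose h l := if l == 0%N then q else p; pose h' l := if l == n.-1 then q else p.
  have -> : altp n.-1 (wrgen M s p) (wrgen M t p) * wrgen M t q = altw M n t s h.
    by rewrite -[in RHS]nE /= -altw_const.
  rewrite (altw_swap (h' := h') ts hM'); last first.
    move=> l ln; rewrite /h /h'; case: l ln => [|l] ln; first by rewrite subn0 !eqxx.
    rewrite (_ : (n.-1 - l.+1 == n.-1)%N = false) //; apply/ltn_eqF.
    by rewrite ltn_subrL /= -ltnS nE (leq_trans _ ln).
  rewrite -{1}nE altwSl /h' eqxx -altw_const -[in RHS]nE /= .
  rewrite (@eq_altw _ M _ n.-1 s t _ (fun=> p)); last by move=> l ln; rewrite ltn_eqF.
  by case: (odd _).
Qed.

Let Xi : G -> _ := va_lift (fun s => wrgen M s q) (fun s => wrgen M s p).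
Let XiM : is_hom Xi := va_liftM cross_respects.

Let Xi_emb w t : (Xi (iot w)).1 t = if crossed w t then p else 1.
Proof.
have Xi2 v : (Xi (iot v)).2 = v.
  elim/cox_gen_ind: v => [|s v IH]; first by rewrite (hom1 (@cox_embM _ M)) (hom1 XiM).
  by rewrite cox_embM XiM /= IH cox_embE /Xi (va_lift_tau cross_respects).
elim/cox_gen_ind: w t => [|s w IH] t.
  by rewrite (hom1 (@cox_embM _ M)) (hom1 XiM) crossed1.
rewrite cox_embM XiM /= IH Xi2 cox_embE /Xi (va_lift_tau cross_respects) /=.
rewrite crossedM crossed_gen /refl_conj.
by case: eqP => _; case: (crossed w t); rewrite ?mulg1 ?mul1g.
Qed.

(** If [w] crossed [c s], the equal elements [iot w * sg s] and [sg s * iot w] would have the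
    coordinates [p * q] and [q * p] at [c s]. *)
Lemma cj_sigma_uncrossed w s : cj w (sg s) = sg s -> ~~ crossed w (c s).
Proof.
move=> e; have ew : w * c s * w^-1 = c s.
  by have := congr1 tot e; rewrite cj_total cox_total_sigma.
have : iot w * sg s = sg s * iot w by rewrite -{2}e /cj mulgVK.
move/(congr1 (fun g => (Xi g).1 (c s))); rewrite !XiM /= !Xi_emb.
have -> : (Xi (iot w)).2 = w.
  elim/cox_gen_ind: w {e ew} => [|t v IH]; first by rewrite (hom1 (@cox_embM _ M)) (hom1 XiM).
  by rewrite cox_embM XiM /= IH cox_embE /Xi (va_lift_tau cross_respects).
rewrite /Xi (va_lift_sigma cross_respects) /= /refl_conj cgenV cgenK mul1g ew eqxx.
by case: (crossed _ _) => // /pq.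
Qed.

(** A nontrivial [w] has a descent, and it moves the sigma of that descent. *)
Lemma cj_faithful w : (forall s, cj w (sg s) = sg s) -> w = 1.
Proof.
move=> h; apply: contrapT => w1.
have hw : gspan (c @` setT) w.
  elim/cox_gen_ind: w {h w1} => [|s w IH]; first exact: gspan1.
  by apply: gspanM => //; apply: gspan_in; exists s.
by have [s _] := crossed_descent hw w1; rewrite (negbTE (cj_sigma_uncrossed (h s))).
Qed.

Definition neg (g : G) : G := cj (tot g) g.

Lemma neg_root g : root g -> root (neg g). Proof. exact: cj_root. Qed.

Lemma total_neg g : tot (neg g) = tot g.
Proof. by rewrite cj_total mulgK. Qed.

Lemma root_total_sq g : root g -> tot g * tot g = 1.
Proof.
move=> [u [s ->]]; rewrite cj_total cox_total_sigma !mulgA mulgVK.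
by rewrite -[u * c s * c s]mulgA cgenK mulg1 mulgV.
Qed.

Lemma negK g : root g -> neg (neg g) = g.
Proof. by move=> hg; rewrite {1}/neg total_neg cj_cj root_total_sq // cj1. Qed.

Lemma neg_inj g h : root g -> root h -> neg g = neg h -> g = h.
Proof. by move=> hg hh e; rewrite -(negK hg) e negK. Qed.

Lemma cj_neg w g : cj w (neg g) = neg (cj w g).
Proof. by rewrite /neg !cj_cj cj_total mulgVK. Qed.

Lemma neg_neq g : root g -> neg g <> g.
Proof.
move=> [u [s ->]]; rewrite -cj_neg => /cj_inj; rewrite /neg cox_total_sigma.
by move/cj_sigma_uncrossed; rewrite crossed_gen eqxx.
Qed.

(** Opposite roots have the same reflection, so the product of their reflections has order 1, while
    labels are at least 2. This is why opposite roots can be put on different sides of an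
    amalgam. *)
Lemma root_pair_neg g h n : root_pair g h n -> h <> neg g.
Proof.
move=> hn e; have := root_pair_ge2 hn.
have gr : root g by case: hn => u [s [t [_ _ -> _]]]; exists u, s.
have : (n %| 1)%N by apply/(root_pair_order 1 hn); rewrite expg1 e total_neg root_total_sq.
by rewrite dvdn1 => /eqP ->.
Qed.

End NegativeRoots.

(** * Normal forms in amalgams *)

Section Amalgam.
Variables (G : groupType) (H : bool -> set G) (Hsub : forall b, is_subgroup (H b)).

Definition amal_core : set G := H true `&` H false.
Local Notation C := amal_core.

Lemma side1 b : H b 1. Proof. by case/is_subgroupP: (Hsub b). Qed.
Lemma sideM b x y : H b x -> H b y -> H b (x * y).
Proof. by case/is_subgroupP: (Hsub b) => _ [h _]; exact: h. Qed.
Lemma sideV b x : H b x -> H b x^-1.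
Proof. by case/is_subgroupP: (Hsub b) => _ [_ h]; exact: h. Qed.
Lemma core_side b x : C x -> H b x. Proof. by case: b => -[]. Qed.
Lemma core1 : C 1. Proof. by split; exact: side1. Qed.
Lemma coreM x y : C x -> C y -> C (x * y).
Proof. by move=> [? ?] [? ?]; split; exact: sideM. Qed.
Lemma coreV x : C x -> C x^-1. Proof. by move=> [? ?]; split; exact: sideV. Qed.
Lemma coreVE x : C x^-1 -> C x. Proof. by move=> /coreV; rewrite invgK. Qed.
Lemma core_mull x y : C x -> C (x * y) -> C y.
Proof. by move=> /coreV hx /(coreM hx); rewrite mulKg. Qed.
Lemma core_mulr x y : C y -> C (x * y) -> C x.
Proof. by move=> /coreV hy /coreM/(_ hy); rewrite mulgK. Qed.

(** A representative of the right coset of [h] modulo the core; [xget] is applied to the coset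
    itself, so the choice depends on nothing else. *)
Definition rep (h : G) : G :=
  if pselect (C h) is left _ then 1 else xget 1 [set x | C (x * h^-1)].

Lemma repP h : C (rep h * h^-1).
Proof.
rewrite /rep; case: pselect => [hh|hn]; first by rewrite mul1g; exact: coreV.
by apply: (@xgetPex _ 1 [set x | C (x * h^-1)]); exists h; rewrite /= mulgV; exact: core1.
Qed.

Lemma rep_mull x h : C x -> rep (x * h) = rep h.
Proof.
move=> hx; rewrite /rep.
have e : C (x * h) <-> C h by split=> [/(core_mull hx)|/(coreM hx)].
case: pselect => h1; case: pselect => h2 //; try by move: h1 h2; rewrite e.
congr (xget 1 _); apply/seteqP; split=> y /=; rewrite invgM mulgA.
  exact: core_mulr (coreV hx).
by move=> hy; apply: coreM hy (coreV hx).
Qed.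

Lemma rep_rep h : rep (rep h) = rep h.
Proof. by rewrite -[in RHS](rep_mull h (repP h)) mulgVK. Qed.

Lemma repV h : C (h * (rep h)^-1).
Proof. by apply: coreVE; rewrite invgM invgK; exact: repP. Qed.

Lemma rep_ncore h : ~ C h -> ~ C (rep h).
Proof. by move=> hh hr; apply: hh; have := coreM (repV h) hr; rewrite mulgVK. Qed.

Lemma rep_side b h : H b h -> H b (rep h).
Proof. by move=> hh; have := sideM (core_side b (repP h)) hh; rewrite mulgVK. Qed.

Definition starts (b : bool) (s : seq (bool * G)) := if s is x :: _ then x.1 == b else false.

Fixpoint nform (s : seq (bool * G)) : Prop :=
  if s is x :: s' then
    [/\ H x.1 x.2, ~ C x.2, rep x.2 = x.2, ~~ starts x.1 s' & nform s']
  else True.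

Definition nstate (p : G * seq (bool * G)) : Prop := C p.1 /\ nform p.2.

(** Merges a head syllable of side [b] into the coefficient, where elements of [H b] multiply
    plainly; [encode b] splits it off again. *)
Definition decode b (p : G * seq (bool * G)) : G * seq (bool * G) :=
  if p.2 is x :: s then if x.1 == b then (p.1 * x.2, s) else p else p.

Definition encode b (p : G * seq (bool * G)) : G * seq (bool * G) :=
  if pselect (C p.1) is left _ then p else (p.1 * (rep p.1)^-1, (b, rep p.1) :: p.2).

Definition opened b (p : G * seq (bool * G)) : Prop :=
  [/\ H b p.1, nform p.2 & ~~ starts b p.2].

Lemma decode_opened b p : nstate p -> opened b (decode b p).
Proof.
case: p => g [|[b' k] s] [/= hg hs]; first by split=> //; exact: core_side.
rewrite /decode /=; case: eqP => [<-|/eqP hb]; last first.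
  by split=> //=; exact: core_side.
by case: hs => /= h1 h2 h3 h4 h5; split=> //=; apply: sideM => //; exact: core_side.
Qed.

Lemma encode_nstate b p : opened b p -> nstate (encode b p).
Proof.
case: p => g s [/= hg hs hb]; rewrite /encode /=; case: pselect => hc //.
split; first exact: repV.
by split=> //=; [exact: rep_side|exact: rep_ncore|exact: rep_rep].
Qed.

Lemma encodeK b p : opened b p -> decode b (encode b p) = p.
Proof.
case: p => g s [/= hg hs hb]; rewrite /encode /=; case: pselect => hc.
  by rewrite /decode /=; case: s hb {hs} => //= x s /negbTE ->.
by rewrite /decode /= eqxx mulgVK.
Qed.

Lemma decodeK b p : nstate p -> encode b (decode b p) = p.
Proof.
case: p => g [|[b' k] s] [/= hg hs]; first by rewrite /encode /=; case: pselect.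
rewrite /decode /=; case: eqP => [<-|/eqP hb]; last by rewrite /encode /=; case: pselect.
case: hs => /= h1 h2 h3 h4 h5; rewrite /encode /=; case: pselect => h.
  by case: h2; exact: core_mull hg h.
by rewrite rep_mull // h3 mulgK.
Qed.

(* The normal form [(g, [:: (b1, x1); ...; (bn, xn)])] stands for the product
   [g x1 ... xn]; with the core on the left, multiplication by an element of [H b]
   only affects [g] and [x1]. *)
Definition amal_act b (x : G) (p : G * seq (bool * G)) : G * seq (bool * G) :=
  if pselect (nstate p) is left _ then encode b (x * (decode b p).1, (decode b p).2) else p.

Lemma opened_mul b x p : H b x -> opened b p -> opened b (x * p.1, p.2).
Proof. by move=> hx [h1 h2 h3]; split=> //=; exact: sideM. Qed.

Lemma amal_act_nstate b x p : H b x -> nstate p -> nstate (amal_act b x p).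
Proof.
move=> hx hp; rewrite /amal_act; case: pselect => // _; apply: encode_nstate.
exact/opened_mul/decode_opened.
Qed.

Lemma amal_actM b x y p : H b x -> H b y -> amal_act b (x * y) p = amal_act b x (amal_act b y p).
Proof.
move=> hx hy; have [hp|hp] := pselect (nstate p); last by rewrite /amal_act; do !case: pselect.
rewrite /amal_act; case: pselect => // _; case: pselect => [h|[]].
  by rewrite encodeK /= ?mulgA //; exact/opened_mul/decode_opened.
exact/encode_nstate/opened_mul/decode_opened.
Qed.

Lemma amal_act1 b p : amal_act b 1 p = p.
Proof.
rewrite /amal_act; case: pselect => // hp; rewrite mul1g.
by rewrite -[LHS]/(encode b (_, _)) -surjective_pairing decodeK.
Qed.

Lemma amal_actK b x y : H b x -> H b y -> y * x = 1 -> cancel (amal_act b x) (amal_act b y).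
Proof. by move=> hx hy e p; rewrite -amal_actM // e amal_act1. Qed.

Definition amal b (x : G) : sym (G * seq (bool * G)) :=
  if pselect (H b x) is left h then
    Sym (amal_actK h (sideV h) (mulVg x)) (amal_actK (sideV h) h (mulgV x))
  else 1.

Lemma amalE b x p : H b x -> amal b x p = amal_act b x p.
Proof. by rewrite /amal; case: pselect. Qed.

Lemma amalM b x y : H b x -> H b y -> amal b (x * y) = amal b x * amal b y.
Proof.
move=> hx hy; apply: symP => p; rewrite symM !amalE ?amal_actM //; exact: sideM.
Qed.

Lemma amal1 b : amal b 1 = 1.
Proof. by apply: symP => p; rewrite amalE ?amal_act1 //; exact: side1. Qed.

Lemma amalV b x : H b x -> amal b x^-1 = (amal b x)^-1.
Proof.
move=> hx; apply: (mulIg (amal b x)); rewrite -amalM ?mulVg ?amal1 //; exact: sideV.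
Qed.

Lemma amal_alt b n x y : H b x -> H b y -> altp n (amal b x) (amal b y) = amal b (altp n x y).
Proof.
move=> hx hy; suff [] : altp n (amal b x) (amal b y) = amal b (altp n x y) /\ H b (altp n x y) by [].
elim: n x y hx hy => [|n IH] x y hx hy /=; first by rewrite amal1; split=> //; exact: side1.
have [-> h] := IH y x hy hx; rewrite -amalM //; split=> //; exact: sideM.
Qed.

Lemma amal_core_state b x g s : C x -> nstate (g, s) -> amal b x (g, s) = (x * g, s).
Proof.
move=> hx hp; rewrite amalE; last exact: core_side.
rewrite /amal_act; case: pselect => // _.
case: s hp => [|[b' k] s] [/= hg hs].
  by rewrite /encode /=; case: pselect => // -[]; exact: coreM.
rewrite /decode /=; case: eqP => [<-|_]; last first.
  by rewrite /encode /=; case: pselect => // -[]; exact: coreM.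
case: hs => /= h1 h2 h3 h4 h5; rewrite /encode /=; case: pselect => h.
  by case: h2; apply: core_mull hg (core_mull hx h).
by rewrite !rep_mull // h3 !mulgA mulgK.
Qed.

(** Makes the permutation of an element of both sides independent of the side, as gluing the two
    actions requires. *)
Lemma amal_core_eq b b' x : C x -> amal b x = amal b' x.
Proof.
move=> hx; apply: symP => -[g s]; have [hp|hp] := pselect (nstate (g, s)).
  by rewrite !amal_core_state.
by rewrite !amalE ?/amal_act; [do !case: pselect|exact: core_side|exact: core_side].
Qed.

Lemma amal_push b x g s : H b x -> ~ C x -> nstate (g, s) -> ~~ starts b s ->
  exists g' k, amal b x (g, s) = (g', (b, k) :: s) /\ nstate (g', (b, k) :: s).
Proof.
move=> hx hxC hp hs; have hp' := amal_act_nstate hx hp.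
rewrite amalE //; move: hp'; rewrite /amal_act; case: pselect => // _.
have -> : decode b (g, s) = (g, s) by rewrite /decode /=; case: s hs {hp} => //= y s /negbTE ->.
rewrite /encode /=; case: pselect => [h|h hp']; last by exists (x * g * (rep (x * g))^-1), (rep (x * g)).
by case: hxC; apply: core_mulr h; case: hp.
Qed.

(** Alternating products of elements outside the core; the two flags are the sides of the first and
    of the last factor. *)
Inductive reduced : bool -> bool -> G -> Prop :=
| reduced_one b x : H b x -> ~ C x -> reduced b b x
| reduced_cons b b' x y : H b x -> ~ C x -> reduced (~~ b) b' y -> reduced b b' (x * y).

Lemma reduced_cat a b d x y : reduced a b x -> reduced (~~ b) d y -> reduced a d (x * y).
Proof.
elim=> {a b x} [b x hx hxC|a b x z hx hxC _ IH] hy; first exact: reduced_cons.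
by rewrite -mulgA; apply: reduced_cons => //; exact: IH.
Qed.

Lemma reducedV a b x : reduced a b x -> reduced b a x^-1.
Proof.
have ncV y : ~ C y -> ~ C y^-1 by move=> h /coreVE.
elim=> {a b x} [b x hx hxC|a b x y hx hxC _ IH].
  by apply: reduced_one; [exact: sideV|exact: ncV].
rewrite invgM; apply: reduced_cat IH _; rewrite negbK.
by apply: reduced_one; [exact: sideV|exact: ncV].
Qed.

Lemma reduced_core_mull x a b y : C x -> reduced a b y -> reduced a b (x * y).
Proof.
move=> hx [{a b y} b y hy hyC|{a b y} a b y z hy hyC hz].
  apply: reduced_one; first by apply: sideM => //; exact: core_side.
  by move=> /(core_mull hx).
rewrite mulgA; apply: reduced_cons => //; first by apply: sideM => //; exact: core_side.
by move=> /(core_mull hx).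
Qed.

Definition split_form x := C x \/ exists a b, reduced a b x.

Lemma split_form_mull b x y : H b x -> split_form y -> split_form (x * y).
Proof.
move=> hx; have [xC|xC] := pselect (C x).
  case=> [hy|[a [d hy]]]; first by left; exact: coreM.
  by right; exists a, d; exact: reduced_core_mull.
case=> [hy|[a [d]]].
  right; exists b, b; apply: reduced_one; first by apply: sideM => //; exact: core_side.
  by move=> /(core_mulr hy).
have [e|ab] := eqVneq a b; last first.
  move=> hy; right; exists b, d; apply: reduced_cons => //.
  by case: a b ab hy {hx} => -[].
move=> hy; case: hy e => [{a d y} a y hy yC|{a d y} a d y z hy yC hz] e; subst a.
  have [xy|xy] := pselect (C (x * y)); first by left.
  by right; exists b, b; apply: reduced_one => //; exact: sideM.
rewrite mulgA; have [xy|xy] := pselect (C (x * y)).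
  by right; exists (~~ b), d; exact: reduced_core_mull.
by right; exists b, d; apply: reduced_cons => //; exact: sideM.
Qed.

(* [th] stands for the action provided by the universal property of the amalgam. *)
Section NormalForm.
Variables (F : set G) (th : G -> sym (G * seq (bool * G))).
Hypotheses (Fsub : is_subgroup F) (HF : forall b, H b `<=` F).
Hypothesis thM : forall x y, F x -> F y -> th (x * y) = th x * th y.
Hypothesis thE : forall b x, H b x -> th x = amal b x.

Lemma reduced_F a b x : reduced a b x -> F x.
Proof.
elim=> {a b x} [b x /HF //|a b x y /HF hx _ _ hy].
by case/is_subgroupP: Fsub => _ [h _]; exact: h.
Qed.

(** Acting on the empty normal form, each factor pushes one syllable, so both flags can be read off
    the resulting list. *)
Lemma reduced_state a b x : reduced a b x -> exists g k s,
  [/\ th x (1, [::]) = (g, (a, k) :: s), nstate (g, (a, k) :: s) & last a (map fst s) = b].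
Proof.
have st0 : nstate (1, [::]) by split=> //; exact: core1.
elim=> {a b x} [b x hx hxC|a b x y hx hxC hy [g [k [s [e hp hl]]]]].
  have [g [k [e hp]]] := amal_push hx hxC st0 isT.
  by exists g, k, [::]; rewrite (thE hx).
have hs : ~~ starts a ((~~ a, k) :: s) by rewrite /=; case: (a).
have [g' [k' [e' hp']]] := amal_push hx hxC hp hs.
exists g', k', ((~~ a, k) :: s); rewrite thM ?symM ?e ?(thE hx) //; first exact: HF hx.
exact: reduced_F hy.
Qed.

Lemma reduced_ncore a b x : reduced a b x -> ~ C x.
Proof.
move=> /reduced_state[g [k [s [e _ _]]]] hx; move: e.
rewrite (thE (core_side true hx)) amal_core_state //.
by split=> //; exact: core1.
Qed.

Lemma reduced_inj a b a' b' x : reduced a b x -> reduced a' b' x -> a = a' /\ b = b'.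
Proof.
move=> /reduced_state[g [k [s [e _ hl]]]] /reduced_state[g' [k' [s' [e' _ hl']]]].
by move: e'; rewrite e => -[_ aa _ ss]; rewrite -hl -hl' aa ss.
Qed.

Lemma reduced_in_side a b d x : reduced a b x -> H d x -> a = d /\ b = d.
Proof.
move=> hr hx; have := reduced_ncore hr => xC.
exact: reduced_inj hr (reduced_one hx xC).
Qed.

Variable z : bool -> G.
Hypotheses (zH : forall b, H b (z b)) (zC : forall b, ~ C (z b)) (zzC : forall b, ~ C (z b * z b)).

Lemma reduced_conj_ncore a b x : reduced a b x -> ~ C (x * z (~~ b) * x^-1).
Proof.
move=> hx; apply: (@reduced_ncore a a); rewrite -mulgA; apply: reduced_cat (hx) _.
by apply: reduced_cons; [exact: zH|exact: zC|rewrite negbK; exact: reducedV hx].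
Qed.

Lemma split_form_conj_ncore x : split_form x -> exists b, ~ C (x * z b * x^-1).
Proof.
case=> [hx|[a [b hx]]]; last by exists (~~ b); exact: reduced_conj_ncore hx.
by exists true => /(core_mulr (coreV hx))/(core_mull hx)/zC.
Qed.

(** For a product of several factors the flags decide unless a = b. In that case the first factor
    lies in [H b], and stripping it leaves a reduced product with both flags [~~ a]. *)
Lemma reduced_conj_side a b x : reduced a b x -> ~ H b (x * z (~~ b) * x^-1).
Proof.
case=> [{a b x} b x hx hxC|{a b x} a b x y hx hxC hy] hH.
  have : H b (z (~~ b)) by have := sideM (sideM (sideV hx) hH) hx; rewrite !mulgA mulVg mul1g mulgVK.
  by move=> h; apply: (@zC (~~ b)); have := zH (~~ b); case: (b) h => ? ?; split.
have hyz : reduced (~~ a) (~~ a) (y * z (~~ b) * y^-1).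
  rewrite -mulgA; apply: reduced_cat (hy) _.
  by apply: reduced_cons; [exact: zH|exact: zC|rewrite negbK; exact: reducedV hy].
have hr : reduced a a (x * (y * z (~~ b) * y^-1) * x^-1).
  rewrite -mulgA; apply: reduced_cons => //; apply: reduced_cat hyz _; rewrite negbK.
  by apply: reduced_one; [exact: sideV|move=> /coreVE].
have e : x * y * z (~~ b) * (x * y)^-1 = x * (y * z (~~ b) * y^-1) * x^-1 by rewrite invgM !mulgA.
rewrite e in hH; have [ab _] := reduced_in_side hr hH; subst b.
have : H a (y * z (~~ a) * y^-1).
  by have := sideM (sideM (sideV hx) hH) hx; rewrite -!mulgA mulKg !mulgA mulgVK.
by move=> /(reduced_in_side hyz)[]; case: (a).
Qed.

Section Commuting.
Hypothesis HFform : forall x, F x -> split_form x.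

Lemma normal_reduced (N : set G) d : N `<=` F -> (forall x y, F y -> N x -> N (y * x * y^-1)) ->
  ~ (N `<=` C) -> exists2 x, N x & reduced d d x.
Proof.
move=> NF NJ /existsNP[x /not_implyP[Nx xC]].
suff [b [y Ny hy]] : exists b, exists2 y, N y & reduced b b y.
  have [->|db] := eqVneq d b; first by exists y.
  exists (z d * y * (z d)^-1); first by apply: NJ => //; exact: HF (zH d).
  have e : ~~ d = b by case: (d) (b) db => -[].
  rewrite -mulgA; apply: reduced_cons; [exact: zH|exact: zC|rewrite e].
  apply: reduced_cat (hy) _; rewrite -e negbK.
  by apply: reduced_one; [exact/sideV/zH|move=> /coreVE/zC].
case: (HFform (NF _ Nx)) => [//|[a [b hx]]].
case: hx Nx xC => [{a b x} b x hx hxC|{a b x} a b x y hx hxC hy] Nx _.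
  by exists b, x => //; exact: reduced_one.
have [ab|ab] := eqVneq a b.
  by subst b; exists a, (x * y) => //; exact: reduced_cons.
have eb : b = ~~ a by case: (a) (b) ab => -[].
subst b.
(* If [z a * x] falls into the core, then [z a * (z a * x)] does not; the hypothesis [zzC] makes the
   square of [z a] admissible. *)
have [k hk [kC kxC]] : exists2 k, H a k & ~ C k /\ ~ C (k * x).
  have [h1|h1] := pselect (C (z a * x)); last by exists (z a); [exact: zH|split=> //; exact: zC].
  exists (z a * z a); first by apply: sideM; exact: zH.
  split; first exact: zzC.
  by rewrite -mulgA => /(core_mulr h1)/zC.
exists a, (k * (x * y) * k^-1); first by apply: NJ => //; exact: HF hk.
have -> : k * (x * y) * k^-1 = (k * x) * (y * k^-1) by rewrite !mulgA.
apply: reduced_cons => //; first exact: sideM.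
apply: reduced_cat (hy) _; rewrite negbK.
by apply: reduced_one; [exact: sideV|move=> /coreVE].
Qed.

(* Nontrivial normal subgroups contain reduced words starting and ending on any
   prescribed side; with opposite sides for [A] and [B], these do not commute. *)
Lemma commuting_normal (A B : set G) : A `<=` F -> B `<=` F ->
  (forall x y, F y -> A x -> A (y * x * y^-1)) ->
  (forall x y, F y -> B x -> B (y * x * y^-1)) ->
  (forall x y, A x -> B y -> commute x y) -> A `<=` C \/ B `<=` C.
Proof.
move=> AF BF AJ BJ AB; have [|nA] := pselect (A `<=` C); first by left.
right; apply: contrapT => nB.
have [a Aa ha] := normal_reduced true AF AJ nA.
have [b Bb hb] := normal_reduced false BF BJ nB.
have hab : reduced true false (a * b) by exact: reduced_cat ha hb.
have hba : reduced false true (b * a) by exact: reduced_cat hb ha.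
by move: hab; rewrite (AB _ _ Aa Bb) => /reduced_inj/(_ hba)[].
Qed.

End Commuting.
End NormalForm.
End Amalgam.

(** * Avoiding roots *)

Section Parabolic.
Variables (S : countType) (M : coxeter_matrix S).
Local Notation W := (cox M).
Local Notation c := (@cgen S M).
Local Notation G := (virtual_artin M).
Local Notation sg := (@sigma S M).
Local Notation ta := (@tau S M).
Local Notation iot := (@cox_emb S M).
Local Notation pr := (@cox_proj S M).
Local Notation tot := (@cox_total S M).
Local Notation root := (@va_roots S M).

(** Only finitely many roots occur in an expression of [f], so those in [P] are removed one at a
    time by [parabolic_inter], even when [P] is infinite. *)
Lemma gspan_avoid (P : set G) f : gspan root f -> (forall b, P b -> gspan (root `\ b) f) ->
  gspan (root `\` P) f.
Proof.
move=> /gspan_finite[s hs hf] hP.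
suff : forall t : seq G, gspan [set x | x \in s /\ ~ (P x /\ x \in t)] f.
  move/(_ s); apply: gspan_subset => x [xs hx]; split; first exact: hs.
  by move=> Px; apply: hx.
elim=> [|b t IH]; first by move: hf; apply: gspan_subset => x xs; split=> // -[].
have [Pb|Pb] := pselect (P b); last first.
  move: IH; apply: gspan_subset => x [xs hx]; split=> // -[Px]; rewrite inE => /orP[/eqP xb|xt].
    by apply: Pb; rewrite -xb.
  by apply: hx.
have : gspan ([set x | x \in s /\ ~ (P x /\ x \in t)] `\ b) f.
  by apply: (parabolic_inter _ (hP _ Pb) IH) => x [/hs].
apply: gspan_subset => x [[xs hx] xb]; split=> // -[Px]; rewrite inE => /orP[/eqP //|xt].
by apply: hx.
Qed.

Let r3 : {perm 'I_3} := tperm ord0 (Ordinal (isT : 1 < 3)) * tperm (Ordinal (isT : 1 < 3)) (Ordinal (isT : 2 < 3)).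

Let r3_sq : r3 * r3 <> 1.
Proof.
move/(congr1 (fun s : {perm 'I_3} => s ord0)); rewrite perm1 permM /r3 !permM tpermL tpermL.
by rewrite (@tpermD _ _ _ (Ordinal (isT : 2 < 3))) // tpermR => /(congr1 val).
Qed.

(** Sending every sigma to the 3-cycle [r3] and every tau to 1 respects the relations and keeps the
    squares of roots nontrivial. *)
Lemma root_sq g : root g -> g * g <> 1.
Proof.
have hr : va_respects M (fun=> r3 : {perm 'I_3}) (fun=> 1).
  split=> //= [s|s t n _ _]; first by rewrite mulg1.
  suff -> : altp n.-1 (1 : {perm 'I_3}) 1 = 1 by rewrite mulg1 mul1g.
  by elim: n.-1 => //= k ->; rewrite mulg1.
have hL := va_liftM hr.
move=> [u [s ->]] /(congr1 (va_lift (fun=> r3 : {perm 'I_3}) (fun=> 1))).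
rewrite (hom1 hL) -cjM /cj !hL (homV hL) (va_lift_sigma hr) => e.
apply: r3_sq; set v := va_lift _ _ _ in e.
by apply: (mulgI v); rewrite -[LHS](mulgK v^-1) invgK e mul1g mulg1.
Qed.

Section OneRoot.
Variables (b : G) (hb : root b).

(** Side [true] contains [b] and side [false] its opposite; [root_end] names the root proper to each
    side. *)
Definition root_side (d : bool) : set G := gspan (root `\ (if d then neg b else b)).
Definition root_end (d : bool) : G := if d then b else neg b.
Local Notation C := (amal_core root_side).

Let Hsub d : is_subgroup (root_side d). Proof. exact: gspan_subgroup. Qed.

Lemma root_end_root d : root (root_end d).
Proof. by case: d => //; exact: neg_root. Qed.

Lemma root_sideE d : root_side d = gspan (root `\ root_end (~~ d)).
Proof. by case: d. Qed.

Lemma root_end_side d : root_side d (root_end d).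
Proof.
apply: gspan_in; split; first exact: root_end_root.
case: d => /= [e|]; first by exact: (neg_neq hb (esym e)).
exact: neg_neq.
Qed.

(** By [parabolic_inter], a power of [g] that avoids [g] is generated by the empty set. *)
Lemma not_gspan_avoid g x : root g -> x <> 1 -> gspan [set g] x -> ~ gspan (root `\ g) x.
Proof.
move=> hg x1 hx h; apply: x1; have : gspan ([set g] `\ g) x.
  by apply: parabolic_inter h hx => y /= ->.
have -> : [set g] `\ g = set0 :> set G by apply/seteqP; split=> y // -[/= ->].
exact: gspan0.
Qed.

Lemma root_neq1 g : root g -> g <> 1.
Proof. by move=> hg e; apply: (root_sq hg); rewrite e mulg1. Qed.

Lemma root_end_ncore d : ~ C (root_end d).
Proof.
move=> /(core_side (~~ d)); rewrite root_sideE negbK.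
apply: not_gspan_avoid; [exact: root_end_root|exact/root_neq1/root_end_root|exact: gspan_in].
Qed.

Lemma root_end_sq_ncore d : ~ C (root_end d * root_end d).
Proof.
move=> /(core_side (~~ d)); rewrite root_sideE negbK.
apply: not_gspan_avoid; [exact: root_end_root|exact/root_sq/root_end_root|].
by apply: gspanM; exact: gspan_in.
Qed.

Lemma root_side_root d : root_side d `<=` gspan root.
Proof. by apply: gspan_subset => x []. Qed.

Lemma root_core g : root g -> g <> b -> g <> neg b -> C g.
Proof. by move=> hg gb gn; split; apply: gspan_in. Qed.

Definition amal_root (g : G) : sym (G * seq (bool * G)) :=
  if pselect (root_side true g) is left _ then amal Hsub true g else amal Hsub false g.

Lemma amal_rootE d g : root_side d g -> amal_root g = amal Hsub d g.
Proof.
rewrite /amal_root; case: pselect => h; case: d => // hd; exact: amal_core_eq.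
Qed.

(** Two roots in a braid relation are not opposite, hence lie on a common side, where the
    permutations multiply as in the group. *)
Lemma amal_root_braid u s t n : s <> t -> M s t = Some n ->
  altp n (amal_root (cj u (sg s))) (amal_root (cj u (sg t))) =
  altp n (amal_root (cj u (sg t))) (amal_root (cj u (sg s))).
Proof.
move=> st hM; have hp : root_pair (cj u (sg s)) (cj u (sg t)) n by exists u, s, t.
set g := cj u _ in hp *; set h := cj u _ in hp *.
have hg : root g by exists u, s.
have hh : root h by exists u, t.
have [d dg dh] : exists2 d, root_side d g & root_side d h.
  have [gn|gn] := pselect (g = neg b).
    exists false; apply: gspan_in; split=> //= e; first by apply: (neg_neq hb); rewrite -gn.
    by apply: (root_pair_neg hp); rewrite gn negK.
  have [hn|hn] := pselect (h = neg b); last by exists true; apply: gspan_in; split.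
  exists false; apply: gspan_in; split=> //= e; last by apply: (neg_neq hb); rewrite -hn.
  by apply: (root_pair_neg hp); rewrite e.
by rewrite !(amal_rootE dg) !(amal_rootE dh) !amal_alt // (root_pair_braid hp).
Qed.

Let th := fiber_hom amal_root.

Let thM x y : gspan root x -> gspan root y -> th (x * y) = th x * th y.
Proof. by move=> _ /proj_ker hy; exact: fiber_homM amal_root_braid _ _ hy. Qed.

Let thE d x : root_side d x -> th x = amal Hsub d x.
Proof.
elim=> {x} [x [hx hn]||x y hx IHx hy IHy|x hx IHx].
- by rewrite /th (fiber_homE amal_root_braid) // (@amal_rootE d) //; apply: gspan_in; split.
- by rewrite /th (fiber_hom1 amal_root_braid) amal1.
- by rewrite thM ?IHx ?IHy ?amalM //; exact: (@root_side_root d).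
- have hx' : pr x = 1 by apply/proj_ker; exact: (@root_side_root d).
  by rewrite /th (fiber_homV amal_root_braid hx') amalV // -IHx.
Qed.

Lemma root_split_form x : gspan root x -> split_form root_side x.
Proof.
elim/gspan_ind_l => [|g f hg hf]; first by left; exact: core1.
suff [d hd] : exists d, root_side d g.
  by split; apply: (split_form_mull Hsub (b := d)) => //; exact: gspanV.
have [gn|gn] := pselect (g = neg b).
  by exists false; rewrite gn; exact: root_end_side.
by exists true; apply: gspan_in.
Qed.

Lemma commuting_normal_root (A B : set G) : A `<=` gspan root -> B `<=` gspan root ->
  (forall x y, gspan root y -> A x -> A (y * x * y^-1)) ->
  (forall x y, gspan root y -> B x -> B (y * x * y^-1)) ->
  (forall x y, A x -> B y -> commute x y) ->
  A `<=` gspan (root `\ b) \/ B `<=` gspan (root `\ b).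
Proof.
move=> AF BF AJ BJ AB.
have [h|h] := commuting_normal (gspan_subgroup root) root_side_root thM thE
   root_end_side root_end_ncore root_end_sq_ncore root_split_form AF BF AJ BJ AB.
  by left=> x /h[].
by right=> x /h[].
Qed.

(** If [w] sent [b] to its opposite, conjugation by [f] would exchange the two ends, against the
    normal form of [f]. If it sent [b] to any further root, both ends would be conjugated into the
    core, whereas some end stays outside. *)
Lemma centralizer_fix (f : G) (w : W) : gspan root f ->
  (forall g, root g -> f * g * f^-1 = cj w g) -> cj w b = b.
Proof.
move=> hf hw; apply: contrapT => wb.
have [wn|wn] := pselect (cj w b = neg b).
  have hz d : f * root_end (~~ d) * f^-1 = root_end d.
    rewrite hw; last exact: root_end_root.
    by case: d => //=; rewrite cj_neg wn negK.
  case: (root_split_form hf) => [hC|[a [d hr]]]; last first.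
    apply: (reduced_conj_side (gspan_subgroup root) root_side_root thM thE root_end_side root_end_ncore hr).
    by rewrite hz; exact: root_end_side.
  apply: (@root_end_ncore false); split; last exact: root_end_side.
  have fs := core_side true hC.
  have : root_side true (f^-1 * root_end true * f).
    by apply: (sideM Hsub) => //; apply: (sideM Hsub); [exact: (sideV Hsub)|exact: root_end_side].
  by rewrite -(hz true) !mulgA mulVg mul1g mulgVK.
have [d] := split_form_conj_ncore (gspan_subgroup root) root_side_root thM thE
   root_end_side root_end_ncore (root_split_form hf).
rewrite hw; last exact: root_end_root.
apply; apply: root_core; first by apply: cj_root; exact: root_end_root.
  case: d => /= e; first exact: wb e.
  by apply: wn; have := congr1 (@neg _ M) e; rewrite cj_neg negK //; exact: (cj_root w hb).
case: d => /= e; first exact: wn e.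
by apply: wb; apply: (neg_inj (cj_root w hb) hb); rewrite -cj_neg.
Qed.

Lemma root_gspan : root b -> ~ gspan (root `\ b) b.
Proof. by move=> _; apply: not_gspan_avoid hb (root_neq1 hb) _; exact: gspan_in. Qed.

End OneRoot.

(** With a = f w, f in F, conjugation by f acts on the roots as w^-1, so w = 1 by faithfulness. Then
    a is in the center of F. The center commutes with F, so for each root one of the two avoids it;
    F does not, so the center avoids every root. *)
Lemma centralizer_trivial (a : G) : (forall x, gspan root x -> commute a x) -> a = 1.
Proof.
move=> ha; set w := pr a; pose f := a * (iot w)^-1.
have hf : gspan root f by exact: proj_decomp.
have hJ g : root g -> f * g * f^-1 = cj w^-1 g.
  move=> hg.
  have e : a * cj w^-1 g * a^-1 = cj w^-1 g by rewrite (ha _ (gspan_in (cj_root w^-1 hg))) mulgK.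
  by rewrite -[RHS]e /f /cj (homV (@cox_embM _ M)) invgM !invgK !mulgA.
have wV1 : w^-1 = 1.
  by apply: (@cj_faithful _ M) => s; exact: (centralizer_fix (sigma_root M s) hf hJ).
have w1 : w = 1 by rewrite -[w]invgK wV1 invg1.
have {}hf : gspan root a by move: hf; rewrite /f w1 (hom1 (@cox_embM _ M)) invg1 mulg1.
pose A := [set x : G | gspan root x /\ forall y, gspan root y -> commute x y].
have Aa : A a by [].
have AF : A `<=` gspan root by move=> x [].
have AJ x y : gspan root y -> A x -> A (y * x * y^-1).
  by move=> hy hx; have [_ /(_ _ hy) e] := hx; rewrite -e mulgK.
have FJ x y : gspan root y -> gspan root x -> gspan root (y * x * y^-1).
  by move=> hy hx; apply: gspanM; [exact: gspanM|exact: gspanV].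
have AFc x y : A x -> gspan root y -> commute x y by case=> _; exact.
have : gspan (root `\` root) a.
  apply: gspan_avoid => // b hb.
  have [h|h] := commuting_normal_root hb AF (@subset_refl _ (gspan root)) AJ FJ AFc; first exact: h.
  by case: (@root_gspan b hb hb); apply/h/gspan_in.
by rewrite setDv => /gspan0.
Qed.

End Parabolic.

(** * Direct factors of virtual Artin groups *)

Section Factors.
Variables (G : groupType) (A B : set G).

Record factors : Prop := Factors {
  factor_l : is_subgroup A; factor_r : is_subgroup B;
  factor_commute : forall x y, A x -> B y -> commute x y;
  factor_prod : forall g, exists a b, [/\ A a, B b & g = a * b];
  factor_meet : forall x, A x -> B x -> x = 1 }.

Hypothesis hAB : factors.

Lemma factor_lM x y : A x -> A y -> A (x * y).
Proof. by case/is_subgroupP: (factor_l hAB) => _ [h _]; exact: h. Qed.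
Lemma factor_lV x : A x -> A x^-1.
Proof. by case/is_subgroupP: (factor_l hAB) => _ [_ h]; exact: h. Qed.
Lemma factor_rM x y : B x -> B y -> B (x * y).
Proof. by case/is_subgroupP: (factor_r hAB) => _ [h _]; exact: h. Qed.
Lemma factor_rV x : B x -> B x^-1.
Proof. by case/is_subgroupP: (factor_r hAB) => _ [_ h]; exact: h. Qed.

Lemma factor_normal g x : A x -> A (g * x * g^-1).
Proof.
move=> Ax; have [a [b [Aa Bb ->]]] := factor_prod hAB g.
rewrite invgM !mulgA -[a * b * x]mulgA -(factor_commute hAB Ax Bb) !mulgA mulgK.
by apply: factor_lM; [exact: factor_lM|exact: factor_lV].
Qed.

End Factors.

Lemma factorsC (G : groupType) (A B : set G) : factors A B -> factors B A.
Proof.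
move=> h; split.
- exact: factor_r h.
- exact: factor_l h.
- by move=> x y Bx Ay; apply/commute_sym; exact: factor_commute h _ _ Ay Bx.
- move=> g; have [a [b [Aa Bb ->]]] := factor_prod h g.
  by exists b, a; split=> //; exact: factor_commute h _ _ Aa Bb.
- by move=> x Bx Ax; exact: factor_meet h _ Ax Bx.
Qed.

Lemma commR_factor (G : groupType) (A B : set G) (hAB : factors A B) (a1 a2 b1 b2 : G) :
  A a1 -> A a2 -> B b1 -> B b2 -> [~ a1 * b1, a2 * b2] = [~ a1, a2] * [~ b1, b2].
Proof.
move=> h1 h2 h3 h4; have cm := factor_commute hAB.
apply: (mulgI (a2 * b2 * (a1 * b1))); rewrite -commgC.
have e1 : a1 * b1 * (a2 * b2) = (a1 * a2) * (b1 * b2).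
  by rewrite !mulgA -[a1 * b1 * a2]mulgA -(cm _ _ h2 h3) !mulgA.
have e2 : a2 * b2 * (a1 * b1) = (a2 * a1) * (b2 * b1).
  by rewrite !mulgA -[a2 * b2 * a1]mulgA -(cm _ _ h1 h4) !mulgA.
rewrite e1 e2 [a1 * a2]commgC [b1 * b2]commgC.
have hA : A [~ a1, a2].
  case/is_subgroupP: (factor_l hAB) => _ [hM hV].
  by rewrite /commg /conjg; apply: (hM); [exact: hV|apply: (hM); [exact: hV|exact: hM]].
have key x y : A x -> (a2 * a1) * x * ((b2 * b1) * y) = (a2 * a1) * (b2 * b1) * (x * y).
  move=> Ax.
  have e : x * (b2 * b1) = b2 * b1 * x by rewrite mulgA (cm _ _ Ax h4) -mulgA (cm _ _ Ax h3) mulgA.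
  by rewrite -[LHS]mulgA [x * (_ * y)]mulgA e !mulgA.
exact: key hA.
Qed.

Section VirtualArtinFactors.
Variables (S : countType) (M : coxeter_matrix S).
Local Notation W := (cox M).
Local Notation c := (@cgen S M).
Local Notation G := (virtual_artin M).
Local Notation sg := (@sigma S M).
Local Notation ta := (@tau S M).
Local Notation iot := (@cox_emb S M).
Local Notation pr := (@cox_proj S M).
Local Notation tot := (@cox_total S M).
Local Notation root := (@va_roots S M).

Lemma altp_even1 (H : groupType) n (x : H) : ~~ odd n -> altp n x 1 = altp n 1 x.
Proof. by move=> /negbTE hn; rewrite !altpE hn mulg1 !mul1g. Qed.

Lemma altp1 (H : groupType) n : altp n 1 1 = 1 :> H.
Proof. by elim: n => //= n ->; rewrite mulg1. Qed.

Definition type_roots (P : set S) : set G := [set g | exists u s, P s /\ g = cj u (sg s)].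

(* The labels between [P] and its complement being even or infinite, the sigmas
   outside [P] can be killed. *)
Section KillSigma.
Variable P : set S.
Hypothesis Podd : forall s t n, s <> t -> M s t = Some n -> odd n -> P s -> P t.

Definition kill_sigma (s : S) : G := if `[< P s >] then sg s else 1.

Lemma kill_respects : va_respects M kill_sigma ta.
Proof.
have hid := va_id_respects M.
have Peq s t n : s <> t -> M s t = Some n -> odd n -> `[< P s >] = `[< P t >].
  move=> st hM hn; apply/asboolP/asboolP; first exact: Podd st hM hn.
  by apply: (Podd (nesym st) _ hn); rewrite cox_label_sym.
split=> [s t n st hM|s t n st hM|s|s t n st hM].
- rewrite /kill_sigma; case: (boolP (odd n)) => hn.
    rewrite (Peq _ _ _ st hM hn); case: asboolP => _; last by rewrite altp1.
    exact: va_sigma hid _ _ _ st hM.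
  case: asboolP => _; case: asboolP => _; rewrite ?altp1 ?(altp_even1 _ hn) //.
  exact: va_sigma hid _ _ _ st hM.
- exact: va_tau hid _ _ _ st hM.
- exact: va_tauK hid s.
- have := va_mixed hid st hM; rewrite /kill_sigma; case: (boolP (odd n)) => hn.
    by rewrite (Peq _ _ _ st hM hn); case: asboolP => // _; rewrite mulg1 mul1g.
  by case: asboolP => // _; rewrite mulg1 mul1g.
Qed.

Definition kill : G -> G := va_lift kill_sigma ta.
Lemma killM : is_hom kill. Proof. exact: va_liftM kill_respects. Qed.

Lemma kill_emb u : kill (iot u) = iot u.
Proof.
elim/cox_gen_ind: u => [|s u IH]; first by rewrite (hom1 (@cox_embM _ M)) (hom1 killM).
by rewrite cox_embM killM IH cox_embE /kill (va_lift_tau kill_respects).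
Qed.

Lemma kill_sigmaE s : kill (sg s) = if `[< P s >] then sg s else 1.
Proof. exact: va_lift_sigma kill_respects s. Qed.

Lemma kill_in x : gspan (type_roots P) x -> kill x = x.
Proof.
elim=> {x} [x [u [s [Ps ->]]]||x y _ hx _ hy|x _ hx].
- by rewrite /cj !killM (homV killM) kill_emb kill_sigmaE asboolT.
- exact: hom1 killM.
- by rewrite killM hx hy.
- by rewrite (homV killM) hx.
Qed.

Lemma kill_out x : gspan (type_roots (~` P)) x -> kill x = 1.
Proof.
elim=> {x} [x [u [s [Ps ->]]]||x y _ hx _ hy|x _ hx].
- by rewrite /cj !killM (homV killM) kill_emb kill_sigmaE asboolF // mulg1 mulgV.
- exact: hom1 killM.
- by rewrite killM hx hy mulg1.
- by rewrite (homV killM) hx invg1.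
Qed.

End KillSigma.

Definition separated (U : set S) := forall s t, U s -> ~ U t -> M s t = Some 2%N.

Lemma separatedC U : separated U -> separated (~` U).
Proof. by move=> h s t Us /contrapT Ut; rewrite cox_label_sym; exact: h. Qed.

Definition para (U : set S) : set G := gspan (sg @` U `|` ta @` U).

Lemma para_sigma (U : set S) s : U s -> para U (sg s).
Proof. by move=> Us; apply: gspan_in; left; exists s. Qed.
Lemma para_tau (U : set S) s : U s -> para U (ta s).
Proof. by move=> Us; apply: gspan_in; right; exists s. Qed.

Lemma label2_commute s t : s <> t -> M s t = Some 2%N ->
  [/\ commute (sg s) (sg t), commute (ta s) (ta t) & commute (ta s) (sg t)].
Proof.
move=> st hM; have hid := va_id_respects M; split.
- by have := va_sigma hid st hM; rewrite /= !mul1g.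
- by have := va_tau hid st hM; rewrite /= !mul1g.
- by have := va_mixed hid st hM; rewrite /= mul1g.
Qed.

Lemma para_commute (U : set S) x y : separated U -> para U x -> para (~` U) y -> commute x y.
Proof.
move=> hU; apply: commute_gspan => {x y} x y hx hy.
have key s t : U s -> ~ U t -> [/\ s <> t, t <> s, M s t = Some 2%N & M t s = Some 2%N].
  move=> Us Ut; have st : s <> t by move=> e; apply: Ut; rewrite -e.
  by split=> //; [exact: nesym|exact: hU|rewrite cox_label_sym; exact: hU].
case: hx hy => -[s Us <-] [] [t Ut <-]; have [st ts h1 h2] := key s t Us Ut.
- by have [] := label2_commute st h1.
- by have [_ _ h] := label2_commute ts h2; exact: commute_sym.
- by have [] := label2_commute st h1.
- by have [] := label2_commute st h1.
Qed.

Section Retract.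
Variables (U : set S) (hU : separated U).

Definition retr (f : S -> G) (s : S) : G := if `[< U s >] then f s else 1.

Lemma retr_respects : va_respects M (retr sg) (retr ta).
Proof.
have hid := va_id_respects M.
have h2 s t n : s <> t -> M s t = Some n -> `[< U s >] != `[< U t >] -> n = 2%N.
  move=> st hM; case: asboolP => Us; case: asboolP => Ut // _.
    by move: hM; rewrite (hU Us Ut) => -[].
  by move: hM; rewrite cox_label_sym (hU Ut Us) => -[].
have gen2 (f : S -> G) s t n : s <> t -> M s t = Some n ->
    altp n (f s) (f t) = altp n (f t) (f s) -> altp n (retr f s) (retr f t) = altp n (retr f t) (retr f s).
  move=> st hM; have := h2 _ _ _ st hM; rewrite /retr.
  by case: asboolP => _; case: asboolP => _ //= hn; rewrite ?altp1 // hn //= ?mul1g ?mulg1.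
split=> [s t n st hM|s t n st hM|s|s t n st hM].
- by apply: gen2 => //; exact: va_sigma hid _ _ _ st hM.
- by apply: gen2 => //; exact: va_tau hid _ _ _ st hM.
- by rewrite /retr; case: asboolP => _; rewrite ?mulg1 //; exact: va_tauK hid s.
- have hm := va_mixed hid st hM; have := h2 _ _ _ st hM; rewrite /retr.
  have [hst|hst] := boolP (`[< U s >] == `[< U t >]).
    move=> _; have -> : `[< U (if odd n then s else t) >] = `[< U t >].
      by case: (odd n) => //; exact/eqP.
    rewrite (eqP hst); case: asboolP => // _; by rewrite altp1 mulg1.
  move=> /(_ isT) n2; move: hm hst; rewrite n2 /= !mul1g => hm.
  by case: asboolP => _; case: asboolP => _ // _; rewrite ?mulg1 ?mul1g.
Qed.

Definition ret : G -> G := va_lift (retr sg) (retr ta).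
Lemma retM : is_hom ret. Proof. exact: va_liftM retr_respects. Qed.
Lemma ret_sigma s : ret (sg s) = retr sg s. Proof. exact: va_lift_sigma retr_respects s. Qed.
Lemma ret_tau s : ret (ta s) = retr ta s. Proof. exact: va_lift_tau retr_respects s. Qed.

Lemma ret_para g : para U (ret g).
Proof.
elim/va_ind: g => [|x y hx hy|x hx|s|s].
- by rewrite (hom1 retM); exact: gspan1.
- by rewrite retM; exact: gspanM.
- by rewrite (homV retM); exact: gspanV.
- by rewrite ret_sigma /retr; case: asboolP => hs; [exact: para_sigma|exact: gspan1].
- by rewrite ret_tau /retr; case: asboolP => hs; [exact: para_tau|exact: gspan1].
Qed.

Lemma ret_id x : para U x -> ret x = x.
Proof.
elim=> {x} [x [] [s Us <-]||x y _ hx _ hy|x _ hx].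
- by rewrite ret_sigma /retr asboolT.
- by rewrite ret_tau /retr asboolT.
- exact: hom1 retM.
- by rewrite retM hx hy.
- by rewrite (homV retM) hx.
Qed.

Lemma ret_disjoint (U' : set S) x : (forall s, U' s -> ~ U s) -> para U' x -> ret x = 1.
Proof.
move=> dis; elim=> {x} [x [] [s /dis Us <-]||x y _ hx _ hy|x _ hx].
- by rewrite ret_sigma /retr asboolF.
- by rewrite ret_tau /retr asboolF.
- exact: hom1 retM.
- by rewrite retM hx hy mulg1.
- by rewrite (homV retM) hx invg1.
Qed.

Lemma ret_type_root (P : set S) x : (forall s, P s -> ~ U s) -> gspan (type_roots P) x -> ret x = 1.
Proof.
move=> dis; elim=> {x} [x [u [s [/dis Us ->]]]||x y _ hx _ hy|x _ hx].
- by rewrite /cj !retM (homV retM) ret_sigma /retr asboolF // mulg1 mulgV.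
- exact: hom1 retM.
- by rewrite retM hx hy mulg1.
- by rewrite (homV retM) hx invg1.
Qed.

End Retract.

Lemma ret_prod U g : separated U -> g = ret U g * ret (~` U) g.
Proof.
move=> hU; have hU' := separatedC hU.
elim/va_ind: g => [|x y hx hy|x hx|s|s].
- by rewrite (hom1 (retM hU)) (hom1 (retM hU')) mulg1.
- rewrite (retM hU) (retM hU') {1}hx {1}hy -!mulgA; congr (_ * _); rewrite !mulgA; congr (_ * _).
  apply/commute_sym/(para_commute hU); exact: ret_para.
- rewrite (homV (retM hU)) (homV (retM hU')) {1}hx invgM; apply/commute_sym.
  by apply: (para_commute hU); apply: gspanV; exact: ret_para.
- rewrite (ret_sigma hU) (ret_sigma hU') /retr; case: asboolP => hs.
    by rewrite asboolF ?mulg1 //; exact.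
  by rewrite asboolT ?mul1g.
- rewrite (ret_tau hU) (ret_tau hU') /retr; case: asboolP => hs.
    by rewrite asboolF ?mulg1 //; exact.
  by rewrite asboolT ?mul1g.
Qed.

Lemma para_normal U g v : separated U -> para U v -> para U (g * v * g^-1).
Proof.
move=> hU hv; rewrite (ret_prod g hU); set a := ret U g; set b := ret (~` U) g.
have ha : para U a by exact: ret_para.
have hb : para (~` U) b by exact/ret_para/separatedC.
rewrite invgM !mulgA -[a * b * v]mulgA -(para_commute hU hv hb) !mulgA mulgK.
by apply: gspanM; [exact: gspanM|exact: gspanV].
Qed.

Section TwoFactors.
Variables (A B : set G).

Hypothesis hAB : factors A B.

Let AM := factor_lM hAB.
Let AV := factor_lV hAB.
Let BM := factor_rM hAB.
Let BV := factor_rV hAB.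

Lemma factor_para (U J : set S) : separated U -> (forall s, J s -> ~ U s) ->
  (forall x, A x -> gspan root x -> gspan (type_roots J) x) -> para U `<=` B.
Proof.
move=> hU JU hA.
have meet a : A a -> para U a -> a = 1.
  move=> Aa Ua; apply: (@centralizer_trivial _ M) => x hx.
  apply: (@commute_gspan _ [set a] root) hx; last exact: gspan_in.
  move=> {x} _ d -> [u [s ed]].
  pose x := a * (d * a^-1 * d^-1).
  suff x1 : x = 1.
    apply: (mulIg a^-1); apply: (mulIg d^-1); apply/esym.
    by rewrite mulgK mulgV -!mulgA -[LHS]x1 /x !mulgA.
  have hx : para U x.
    apply: gspanM => //; apply: para_normal => //; exact: gspanV.
  rewrite -(ret_id hU hx); have [Us|Us] := pselect (U s); last first.
    have d1 : ret U d = 1.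
      by apply: (ret_type_root hU (P := ~` U)) => //; apply: gspan_in; exists u, s.
    by rewrite /x !(retM hU) !(homV (retM hU)) d1 mul1g invg1 mulg1 mulgV.
  apply: (ret_type_root hU JU); apply: hA.
    by apply: AM => //; apply: (factor_normal hAB); exact: AV.
  apply/proj_ker; have hd : pr d = 1 by rewrite ed; apply: root_proj; exists u, s.
  by rewrite /x !(@cox_projM _ M) !(homV (@cox_projM _ M)) hd mul1g invg1 mulg1 mulgV.
move=> v hv; have [a [b [Aa Bb ev]]] := factor_prod hAB v.
have hU' := separatedC hU.
(* If two products commute, the commutator of their [A]-parts lies in [B] as well, so the [A]-parts
   commute. *)
have a_comm v' : para (~` U) v' -> commute a v'.
  move=> hv'; have [a' [b' [Aa' Bb' ev']]] := factor_prod hAB v'.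
  have vv : v * v' = v' * v by exact: para_commute hv hv'.
  have e : (a' * a)^-1 * (a * a') = (b' * b) * (b * b')^-1.
    apply: (mulgI (a' * a)); apply: (mulIg (b * b')).
    rewrite mulVKg -[RHS]mulgA mulgVK.
    have c1 := factor_commute hAB Aa' Bb; have c2 := factor_commute hAB Aa Bb'.
    transitivity (v * v').
      by rewrite ev ev' !mulgA -[a * b * a']mulgA -c1 !mulgA.
    by rewrite vv ev ev' !mulgA -[a' * b' * a]mulgA -c2 !mulgA.
  have : (a' * a)^-1 * (a * a') = 1.
    apply: (factor_meet hAB); first by apply: AM; [exact/AV/AM|exact: AM].
    by rewrite e; apply: BM; [exact: BM|exact/BV/BM].
  move=> e1; have aa : commute a a' by apply: (mulgI (a' * a)^-1); rewrite e1 mulVg.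
  by rewrite ev'; apply: commuteM => //; exact: factor_commute hAB _ _ Aa Bb'.
(* This projection of [a] is central: it commutes with [para U], and differs from [a] by an element
   of [para U], which commutes with the complement as [a] does. *)
set d := ret (~` U) a.
have hd : para (~` U) d by exact: ret_para.
have d1 : d = 1.
  apply: (@centralizer_trivial _ M) => x _; rewrite (ret_prod x hU).
  apply: commuteM; first by apply/commute_sym/(para_commute hU) => //; exact: ret_para.
  have hx : para (~` U) (ret (~` U) x) by exact: ret_para.
  have -> : d = (ret U a)^-1 * a by rewrite {2}(ret_prod a hU) mulKg.
  apply/commute_sym/commuteM; last exact/commute_sym/a_comm.
  by apply/commuteV/commute_sym/(para_commute hU) => //; exact: ret_para.
have : para U a by rewrite (ret_prod a hU) -/d d1 mulg1; exact: ret_para.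
by move=> /(meet _ Aa) a1; rewrite ev a1 mul1g.
Qed.

End TwoFactors.

(** Connectedness in the Coxeter graph, stated as the propagation of any property along edges. *)
Definition indecomposable_set (U : set S) := forall P : set S,
  (forall s t, U s -> U t -> s <> t -> M s t <> Some 2%N -> P s -> P t) -> forall s t, U s -> U t -> P s -> P t.

Theorem factor_dichotomy A B (U : set S) : factors A B -> separated U -> indecomposable_set U ->
  U !=set0 -> para U `<=` A \/ para U `<=` B.
Proof.
move=> hAB hU hconn [s0 Us0].
pose A0 := [set x | A x /\ gspan root x]; pose B0 := [set x | B x /\ gspan root x].
have normF x y : gspan root x -> gspan root (y * x * y^-1).
  by move=> /proj_ker hx; apply/proj_ker; rewrite !(@cox_projM _ M) (homV (@cox_projM _ M)) hx mulg1 mulgV.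
have A0J x y : A0 x -> A0 (y * x * y^-1).
  by move=> [Ax Fx]; split; [exact: factor_normal hAB _ _ Ax|exact: normF].
have B0J x y : B0 x -> B0 (y * x * y^-1).
  by move=> [Bx Fx]; split; [exact: factor_normal (factorsC hAB) _ _ Bx|exact: normF].
pose I s := A0 `<=` gspan (root `\ sg s).
have hIB s : ~ I s -> B0 `<=` gspan (root `\ sg s).
  move=> nI; have [||x y _|x y _|x y [Ax _] [By _]|//|//] := @commuting_normal_root _ M _ (sigma_root M s) A0 B0.
  - by move=> x [].
  - by move=> x [].
  - exact: A0J.
  - exact: B0J.
  - exact: factor_commute hAB _ _ Ax By.
have conj_avoid (N : set G) s u : (forall x y, N x -> N (y * x * y^-1)) ->
    N `<=` gspan (root `\ sg s) -> N `<=` gspan (root `\ cj u (sg s)).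
  move=> NJ h x Nx.
  have hx : N (cj u^-1 x) by apply: NJ.
  rewrite -(cjVK u x); apply: gspan_hom (cjM u) _ _ (h _ hx) => y [hy ys].
  by apply: gspan_in; split; [exact: cj_root|move=> /= /cj_inj].
have A0I : A0 `<=` gspan (type_roots (~` I)).
  move=> x Ax; have : gspan (root `\` type_roots I) x.
    apply: gspan_avoid; first by case: Ax.
    by move=> b [u [s [Is ->]]]; apply: (conj_avoid A0 s u A0J Is).
  apply: gspan_subset => y [[u [s ->]] hy]; exists u, s; split=> // Is.
  by apply: hy; exists u, s.
have B0I : B0 `<=` gspan (type_roots I).
  move=> x Bx; have : gspan (root `\` type_roots (~` I)) x.
    apply: gspan_avoid; first by case: Bx.
    by move=> b [u [s [Is ->]]]; apply: (conj_avoid B0 s u B0J (hIB _ Is)).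
  apply: gspan_subset => y [[u [s ->]] hy]; exists u, s; split=> //.
  by apply: contrapT => Is; apply: hy; exists u, s.
(* An odd label makes the two sigmas conjugate under [W], so the normal subgroup [A0] avoids both or
   neither; this is what killing sigmas requires. *)
have Iodd s t n : s <> t -> M s t = Some n -> odd n -> I s -> I t.
  move=> st hM hn Is; have hM' : M t s = Some n by rewrite cox_label_sym.
  by have := cj_alt (nesym st) hM'; rewrite hn /I => <-; apply: (conj_avoid A0 s _ A0J Is).
have Iodd' s t n : s <> t -> M s t = Some n -> odd n -> (~` I) s -> (~` I) t.
  move=> st hM hn nIs It; apply: nIs; apply: (Iodd t s n) => //; first exact: nesym.
  by rewrite cox_label_sym.
have split_comm s t : s <> t -> I s -> ~ I t -> M s t = Some 2%N.
  move=> st Is nIt.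
  have [a1 [b1 [Aa1 Bb1 e1]]] := factor_prod hAB (sg s).
  have [a2 [b2 [Aa2 Bb2 e2]]] := factor_prod hAB (sg t).
  have eR : [~ sg s, sg t] = [~ a1, a2] * [~ b1, b2].
    by rewrite {1}e1 {1}e2 (commR_factor hAB).
  have commF x y : gspan root x -> gspan root [~ x, y].
    by move=> hx; apply: gspanM; [exact: gspanV|rewrite /conjg mulgA -{2}[y]invgK; exact: normF].
  have hsF : gspan root (sg s) by apply/gspan_in/sigma_root.
  have R_closed (K : set G) x y : is_subgroup K -> K x -> K y -> K [~ x, y].
    case/is_subgroupP=> _ [hM hV] hx hy; rewrite /commg /conjg.
    by apply: (hM); [exact: hV|apply: (hM); [exact: hV|exact: hM]].
  have one (K : set G) : is_subgroup K -> K 1 by case/is_subgroupP.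
  (* This is also the commutator of [sg s] with [a2], hence lies in the normal subgroup F; likewise
     the [B]-part with [b2]. *)
  have xA0 : A0 [~ a1, a2].
    split; first exact: R_closed (factor_l hAB) Aa1 Aa2.
    have := commR_factor hAB Aa1 Aa2 Bb1 (one _ (factor_r hAB)).
    by rewrite mulg1 commg1 mulg1 -e1 => <-; exact: commF.
  have yB0 : B0 [~ b1, b2].
    split; first exact: R_closed (factor_r hAB) Bb1 Bb2.
    have := commR_factor hAB Aa1 (one _ (factor_l hAB)) Bb1 Bb2.
    by rewrite mul1g commg1 mul1g -e1 => <-; exact: commF.
  (* [kill I] sends [sg t] and all of [A0] to 1 and fixes [B0], so it leaves only this factor. *)
  have y1 : [~ b1, b2] = 1.
    have := congr1 (kill I) eR; rewrite (homR (killM Iodd)) (killM Iodd) !(kill_sigmaE Iodd).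
    rewrite (asboolF nIt) commg1 (kill_in Iodd (B0I _ yB0)).
    by rewrite (kill_out Iodd (A0I _ xA0)) mul1g.
  have x1 : [~ a1, a2] = 1.
    have := congr1 (kill (~` I)) eR; rewrite (homR (killM Iodd')) (killM Iodd') !(kill_sigmaE Iodd').
    rewrite asboolF // comm1g (kill_in Iodd' (A0I _ xA0)).
    by rewrite (kill_out Iodd') ?mulg1 // setCK; exact: B0I.
  have : commute (sg s) (sg t) by apply/commgP/eqP; rewrite eR x1 y1 mulg1.
  move/(congr1 tot); rewrite !(@cox_totalM _ M) !cox_total_sigma => e.
  have : (c s * c t) ^+ 2 = 1.
    by rewrite expg2 {1}e !mulgA -[c t * c s * c s]mulgA cgenK mulg1 cgenK.
  case/(cgen_order st) => // -[n hM /dvdn_leq hn]; rewrite hM; congr Some.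
  by apply/eqP; rewrite eqn_leq hn // (cox_label_ge2 st hM).
have I_or s t : U s -> U t -> I s -> I t.
  apply: hconn => {}s {}t _ _ st h2 Is; apply: contrapT => nIt.
  by apply: h2; exact: split_comm.
have [Is0|nIs0] := pselect (I s0).
  right; apply: (factor_para hAB (J := ~` I)) => // [s nIs Us|x Ax Fx].
    by apply: nIs; exact: I_or Us0 Us Is0.
  exact: A0I.
left; apply: (factor_para (factorsC hAB) (J := I)) => // [s Is Us|x Bx Fx].
  by apply: nIs0; exact: I_or Us Us0 Is.
exact: B0I.
Qed.

End VirtualArtinFactors.

(** * Remak decompositions *)

Section Components.
Variables (S : countType) (M : coxeter_matrix S).
Local Notation comp := (coxeter_component M).
Local Notation edge := (coxeter_edge M).

Lemma edge_sym s t : edge s t = edge t s.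
Proof. by rewrite /coxeter_edge eq_sym cox_label_sym. Qed.

Lemma comp_refl s : comp s s. Proof. by exists [::]. Qed.

Lemma comp_trans s t u : comp s t -> comp t u -> comp s u.
Proof.
move=> [p hp <-] [q hq <-]; exists (p ++ q); last by rewrite last_cat.
by rewrite cat_path hp.
Qed.

Lemma comp_edge s t : edge s t -> comp s t.
Proof. by move=> e; exists [:: t]; rewrite //= e. Qed.

Lemma comp_sym s t : comp s t -> comp t s.
Proof.
move=> [p]; elim: p s => [|x p IH] s /=; first by move=> _ ->; exact: comp_refl.
move=> /andP[e hp] hl; apply: comp_trans (IH x hp hl) _.
by apply: comp_edge; rewrite edge_sym.
Qed.

Lemma comp_eq s t : comp s t -> comp s = comp t.
Proof.
move=> h; apply/seteqP; split=> u; first exact/comp_trans/comp_sym.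
exact: comp_trans.
Qed.

Lemma nonedge s t : s <> t -> ~~ edge s t -> M s t = Some 2%N.
Proof.
move=> st; rewrite /coxeter_edge (introN eqP st) /=.
case e : (M s t) => [n|//]; rewrite -ltnNge ltnS => hn; congr Some.
by apply/eqP; rewrite eqn_leq hn (cox_label_ge2 st e).
Qed.

Lemma comp_separated s : separated M (comp s).
Proof.
move=> t u ht hu; apply: nonedge => [e|]; first by apply: hu; rewrite -e.
by apply/negP => /comp_edge h; apply: hu; exact: comp_trans ht h.
Qed.

Lemma comp_indecomposable s0 : indecomposable_set M (comp s0).
Proof.
move=> P hP s t hs ht.
have : comp s t by exact: comp_trans (comp_sym hs) ht.
move=> [p]; elim: p s hs => [|x p IH] s hs /=; first by move=> _ ->.
move=> /andP[e hp] hl Ps; have hx := comp_trans hs (comp_edge e).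
apply: (IH x hx hp hl); apply: hP Ps => //; move: e; rewrite /coxeter_edge => /andP[/eqP//].
by move=> _ e2 e3; rewrite e3 in e2.
Qed.

End Components.

Section DirectProduct.
Variables (G : groupType) (l : nat) (H : 'I_l -> set G).
Hypothesis hH : internal_direct_product [set: G] H.

Lemma idp_subgroup i : is_subgroup (H i). Proof. by case: hH. Qed.
Let H1 i : H i 1. Proof. by case/is_subgroupP: (idp_subgroup i). Qed.
Let HM i x y : H i x -> H i y -> H i (x * y).
Proof. by case/is_subgroupP: (idp_subgroup i) => _ [h _]; exact: h. Qed.
Let HV i x : H i x -> H i x^-1.
Proof. by case/is_subgroupP: (idp_subgroup i) => _ [_ h]; exact: h. Qed.
Let Hcomm i j x y : i != j -> H i x -> H j y -> commute x y.
Proof. by case: hH => _ _ h _ ij hx hy; exact: h ij x y hx hy. Qed.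

Definition idp_family (h : 'I_l -> G) := forall i, H i (h i).
Definition idp_prod (h : 'I_l -> G) : G := \prod_(i < l) h i.

Lemma idp_surj g : exists2 h, idp_family h & g = idp_prod h.
Proof. by case: hH => _ _ _ [_ _ /(_ g I)[h hh <-]]; exists h. Qed.

Lemma idp_inj h h' : idp_family h -> idp_family h' -> idp_prod h = idp_prod h' -> h = h'.
Proof. by case: hH => _ _ _ [_ hi _] hh hh'; apply: hi; apply/mem_set. Qed.

Lemma idp_prodM h h' : idp_family h -> idp_family h' ->
  idp_prod (fun i => h i * h' i) = idp_prod h * idp_prod h'.
Proof.
move=> hh hh'; rewrite /idp_prod; have := index_enum_uniq 'I_l.
elim: (index_enum _) => [|i r IH] /=; first by rewrite !big_nil mulg1.
move=> /andP[ir ur]; rewrite !big_cons IH // !mulgA; congr (_ * _); rewrite -!mulgA; congr (_ * _).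
rewrite big_seq; apply: commute_prod => j jr.
apply: (@Hcomm i j) => //; apply: contraNneq ir => e; by rewrite e.
Qed.

Definition idp_single i x : 'I_l -> G := fun j => if j == i then x else 1.

Lemma idp_singleP i x : H i x -> idp_family (idp_single i x).
Proof. by move=> hx j; rewrite /idp_single; case: eqP => [->|]. Qed.

Lemma idp_prod_single i x : idp_prod (idp_single i x) = x.
Proof. by rewrite /idp_prod /idp_single -big_mkcond /= (big_pred1_eq _ i (fun=> x)). Qed.

Lemma idp_prod1 : idp_prod (fun=> 1) = 1.
Proof. by rewrite /idp_prod big1_eq. Qed.

Definition idp_compl i : set G := [set g | exists h, [/\ idp_family h, h i = 1 & g = idp_prod h]].

Lemma idp_factors i : factors (H i) (idp_compl i).
Proof.
split; first exact: idp_subgroup.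
- apply/is_subgroupP; split.
    by exists (fun=> 1); split=> [j||]; rewrite ?idp_prod1.

  split=> [x y [h [hh hi ->]] [h' [hh' hi' ->]]|x [h [hh hi ->]]].
    exists (fun j => h j * h' j); split; last by rewrite idp_prodM.
      by move=> j; exact: HM.
    by rewrite hi hi' mulg1.
  have hV : idp_family (fun j => (h j)^-1) by move=> j; exact: HV.
  exists (fun j => (h j)^-1); split=> //; first by rewrite hi invg1.
  apply: mulg1_eq; rewrite -idp_prodM // -[RHS]idp_prod1; congr idp_prod.
  by apply/funext => j; rewrite mulgV.
- move=> x y hx [h [hh hi ->]]; apply: commute_prod => j _.
  have [->|ji] := eqVneq j i; first by rewrite hi; exact: commute1.
  by apply: (@Hcomm i j) => //; rewrite eq_sym.
- move=> g; have [h hh ->] := idp_surj g.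
  have hr : idp_family (fun j => if j == i then 1 else h j) by move=> j; case: eqP.
  exists (h i), (idp_prod (fun j => if j == i then 1 else h j)); split=> //.
    by exists (fun j => if j == i then 1 else h j); split; rewrite ?eqxx.
  rewrite -{1}(idp_prod_single i (h i)) -idp_prodM //; last exact: idp_singleP.
  congr idp_prod; apply/funext => j; rewrite /idp_single.
  by case: eqP => [->|]; rewrite ?mulg1 ?mul1g.
- move=> x hx [h [hh hi ex]].
  have : idp_single i x = h by apply: idp_inj; [exact: idp_singleP|by []|rewrite idp_prod_single].
  by move/(congr1 (fun k => k i)); rewrite /idp_single eqxx hi.
Qed.

Lemma idp_compl_sub i i' : i != i' -> H i' `<=` idp_compl i.
Proof.
move=> ii x hx; exists (idp_single i' x); split; first exact: idp_singleP.
  by rewrite /idp_single (negbTE ii).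
by rewrite idp_prod_single.
Qed.

Lemma idp_compl_all x : (forall i, idp_compl i x) -> x = 1.
Proof.
move=> hx; have [h hh ex] := idp_surj x; rewrite ex -idp_prod1; congr idp_prod.
apply/funext => i; have [h' [hh' hi' ex']] := hx i.
by rewrite -hi'; congr (_ i); apply: idp_inj; rewrite // -ex.
Qed.

End DirectProduct.

Lemma internal_direct_product2 (G : groupType) (D H K : set G) :
  is_subgroup D -> is_subgroup H -> is_subgroup K -> H `<=` D -> K `<=` D ->
  (forall x y, H x -> K y -> commute x y) ->
  (forall g, D g -> exists a b, [/\ H a, K b & g = a * b]) ->
  (forall x, H x -> K x -> x = 1) -> internal_direct_product D (tnth [tuple H; K]).
Proof.
move=> hD hH hK HD KD cm dec meet.
have t0 (i : 'I_2) : i = ord0 \/ i = lift ord0 ord0.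
  by case: i => -[|[|//]] hi; [left|right]; apply/val_inj.
have e0 : tnth [tuple H; K] ord0 = H by [].
have e1 : tnth [tuple H; K] (lift ord0 ord0) = K by [].
have pE (h : 'I_2 -> G) : \prod_(i < 2) h i = h ord0 * h (lift ord0 ord0).
  by rewrite big_ord_recl big_ord_recl big_ord0 mulg1.
have memD (h : 'I_2 -> G) : (forall i, tnth [tuple H; K] i (h i)) -> H (h ord0) /\ K (h (lift ord0 ord0)).
  by move=> hh; have := hh ord0; have := hh (lift ord0 ord0); rewrite e0 e1.
split=> //.
- by move=> i; case: (t0 i) => ->; rewrite ?e0 ?e1.
- move=> i j ij x y; case: (t0 i) (t0 j) ij => -> [] -> //.
    by rewrite e0 e1 => _; exact: cm.
  by rewrite e0 e1 => _ Kx Hy; apply/commute_sym; exact: cm.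
- split.
  + move=> h /memD[h0 h1] /=; rewrite pE.
    by case/is_subgroupP: hD => _ [hM _]; apply: hM; [exact: HD|exact: KD].
  + move=> h h' /set_mem/memD[h0 h1] /set_mem/memD[h0' h1']; rewrite !pE => e.
    have HM : is_subgroup H := hH; case/is_subgroupP: HM => _ [HM HV].
    have KM : is_subgroup K := hK; case/is_subgroupP: KM => _ [KM KV].
    have e2 : (h' ord0)^-1 * h ord0 = h' (lift ord0 ord0) * (h (lift ord0 ord0))^-1.
      by apply: (mulgI (h' ord0)); apply: (mulIg (h (lift ord0 ord0))); rewrite mulVKg e mulgA mulgVK.
    have e3 : (h' ord0)^-1 * h ord0 = 1.
      by apply: meet; [exact: HM (HV _ h0') h0|rewrite e2; exact: KM h1' (KV _ h1)].
    apply/funext => i; case: (t0 i) => ->.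
      by apply: (mulgI (h' ord0)^-1); rewrite e3 mulVg.
    by apply: (mulIg (h (lift ord0 ord0))^-1); rewrite -e2 e3 mulgV.
  + move=> g /dec[a [b [Ha Kb ->]]]; exists (fun i => if i == ord0 then a else b).
      by move=> i; case: (t0 i) => ->.
    by rewrite pE.
Qed.

Theorem theorem6p1 (S : countType) (M : coxeter_matrix S) (k l : nat)
    (C : 'I_k -> set S) (H : 'I_l -> set (virtual_artin M)) :
  enumerates_components M C ->
  Remak_decomposition H ->
  k = l /\
  exists f : 'I_k -> 'I_l,
    bijective f /\ forall i : 'I_k, H (f i) = va_parabolic M (C i).
Proof.
move=> [Cinj Crange] [hH hR].
have vaE U : va_parabolic M U = @para S M U by exact: generated_subgroupE.
have Ccomp j : exists s, C j = coxeter_component M s.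
  have : range C (C j) by exists j.
  by rewrite Crange => -[s _ <-]; exists s.
have Cmem j s : C j s -> C j = coxeter_component M s.
  by have [t ->] := Ccomp j; exact: comp_eq.
have Cex s : exists j, C j s.
  have : range C (coxeter_component M s) by rewrite Crange; exists s.
  by move=> [j _ e]; exists j; rewrite e; exact: comp_refl.
have Cdisj j j' s : C j s -> C j' s -> j = j'.
  by move=> /Cmem e /Cmem e'; apply: Cinj; rewrite e e'.
have Csep j : separated M (C j) by have [s ->] := Ccomp j; exact: comp_separated.
have Cind j : indecomposable_set M (C j) by have [s ->] := Ccomp j; exact: comp_indecomposable.
have tau1 s : tau M s <> 1.
  move/(congr1 (@cox_proj _ M)); rewrite cox_proj_tau (hom1 (@cox_projM _ M)).
  exact: cgen_neq1.
have Cne j : exists s, C j s by have [s ->] := Ccomp j; exists s; exact: comp_refl.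
(* Otherwise the component would lie in the complement of every factor; these meet trivially, but
   its taus are not 1. *)
have ex_f j : exists i, @para S M (C j) `<=` H i.
  apply: contrapT => no; have [s Cs] := Cne j.
  apply: (tau1 s); apply: (idp_compl_all hH) => i.
  have [h|h] := factor_dichotomy (idp_factors hH i) (Csep j) (Cind j) (Cne j).
    by case: no; exists i.
  by apply: h; exact: para_tau.
have [f hf] := choice ex_f.
pose V i := [set s | exists2 j, C j s & f j = i].
have fV s j : C j s -> V (f j) s by exists j.
(* Each generator lies in [para (V i)] or in the complement of [H i], so every element is a product
   of two such parts; for an element of [H i] the second part is trivial. *)
have HE i : H i = @para S M (V i).
  have sub : @para S M (V i) `<=` H i.
    apply: gspan_sub (idp_subgroup hH i) _ => x [] [s [j Cs <-] <-].
      by apply: hf; exact: para_sigma.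
    by apply: hf; exact: para_tau.
  apply/seteqP; split=> // g Hg; have F := idp_factors hH i.
  pose Q g := exists a b, [/\ @para S M (V i) a, idp_compl H i b & g = a * b].
  have Q_in a : @para S M (V i) a -> Q a.
    by move=> ha; exists a, 1; rewrite mulg1; split=> //; case/is_subgroupP: (factor_r F).
  have Q_out b : idp_compl H i b -> Q b.
    by move=> hb; exists 1, b; rewrite mul1g; split=> //; exact: gspan1.
  have [a [b [ha hb e]]] : Q g.
    elim/va_ind: g {Hg} => [|x y [a [b [ha hb ->]]] [a' [b' [ha' hb' ->]]]|x [a [b [ha hb ->]]]|s|s].
    - by apply: Q_in; exact: gspan1.
    - exists (a * a'), (b * b'); split; first exact: gspanM.
        by case/is_subgroupP: (factor_r F) => _ [hM _]; exact: hM.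
      by rewrite !mulgA -[a * b * a']mulgA -(factor_commute F (sub _ ha') hb) !mulgA.
    - exists a^-1, b^-1; split; first exact: gspanV.
        by case/is_subgroupP: (factor_r F) => _ [_ hV]; exact: hV.
      by rewrite (factor_commute F (sub _ ha) hb) invgM.
    - have [j Cs] := Cex s; have [fi|fi] := eqVneq (f j) i.
        by apply: Q_in; apply: para_sigma; exists j.
      apply: Q_out; apply: (idp_compl_sub hH (i' := f j)); first by rewrite eq_sym.
      by apply: hf; exact: para_sigma.
    - have [j Cs] := Cex s; have [fi|fi] := eqVneq (f j) i.
        by apply: Q_in; apply: para_tau; exists j.
      apply: Q_out; apply: (idp_compl_sub hH (i' := f j)); first by rewrite eq_sym.
      by apply: hf; exact: para_tau.
  have b1 : b = 1.
    apply: (factor_meet F) => //; case/is_subgroupP: (idp_subgroup hH i) => _ [hM hV].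
    have -> : b = a^-1 * g by rewrite e mulKg.
    by apply: (hM) => //; apply: hV; exact: sub.
  by rewrite e b1 mulg1.
have fsurj i : exists j, f j = i.
  apply: contrapT => no; have [/(_ _)] := hR i; case.
  rewrite HE; apply/seteqP; split=> x /=; last by move=> ->; exact: gspan1.
  have -> : V i = set0 by apply/seteqP; split=> // s [j _ fj]; apply: no; exists j.
  by rewrite /para !image_set0 setU0; exact: gspan0.
(* Two components in one factor would decompose it into the first of them and the rest, both
   proper. *)
have finj : injective f.
  move=> j j' e; apply: contrapT => jj'; pose i := f j.
  have [_ ] := hR i; apply.
  have [s Cs] := Cne j; have [s' Cs'] := Cne j'.
  pose U' := V i `\` C j.
  have U'C t : U' t -> ~ C j t by case.
  have Vs : V i s by exists j.
  have Vs' : V i s' by exists j'.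
  have U's' : U' s' by split=> // Cjs'; apply: jj'; exact: Cdisj Cjs' Cs'.
  have hCV : @para S M (C j) `<=` H i by exact: hf.
  have hUV : @para S M U' `<=` H i.
    rewrite HE; apply: gspan_subset => x [] [t [Vt _] <-]; by [left; exists t|right; exists t].
  have meet x : @para S M (C j) x -> @para S M U' x -> x = 1.
    by move=> h1 h2; rewrite -(ret_id (Csep j) h1); apply: (ret_disjoint (Csep j) U'C h2).
  have cm x y : @para S M (C j) x -> @para S M U' y -> commute x y.
    move=> h1 h2; apply: (para_commute (Csep j) h1); move: h2; apply: gspan_subset => z [] [t [_ nt] <-];
    by [left; exists t|right; exists t].
  exists (@para S M (C j)), (@para S M U'); split.
  - move=> eH; apply: (tau1 s'); apply: meet; last exact: para_tau.
    by rewrite eH HE; exact: para_tau.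
  - move=> eH; apply: (tau1 s); apply: meet; first exact: para_tau.
    by rewrite eH HE; exact: para_tau.
  - apply: internal_direct_product2 => //; try exact: gspan_subgroup.
      exact: idp_subgroup hH i.
    move=> g; rewrite HE => hg.
    pose Q g := exists a b, [/\ @para S M (C j) a, @para S M U' b & g = a * b].
    rewrite -/(Q g); elim: hg => {g} [g [] [t Vt <-]||x y _ [a [b [ha hb ->]]] _ [a' [b' [ha' hb' ->]]]|x _ [a [b [ha hb ->]]]].
    + have [Ct|Ct] := pselect (C j t).
        by exists (sigma M t), 1; rewrite mulg1; split=> //; [exact: para_sigma|exact: gspan1].
      by exists 1, (sigma M t); rewrite mul1g; split=> //; [exact: gspan1|exact: para_sigma].
    + have [Ct|Ct] := pselect (C j t).
        by exists (tau M t), 1; rewrite mulg1; split=> //; [exact: para_tau|exact: gspan1].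
      by exists 1, (tau M t); rewrite mul1g; split=> //; [exact: gspan1|exact: para_tau].
    + by exists 1, 1; rewrite mulg1; split=> //; exact: gspan1.
    + exists (a * a'), (b * b'); split; [exact: gspanM|exact: gspanM|].
      by rewrite !mulgA -[a * b * a']mulgA -(cm _ _ ha' hb) !mulgA.
    + exists a^-1, b^-1; split; [exact: gspanV|exact: gspanV|].
      by rewrite (cm _ _ ha hb) invgM.
have fbij : bijective f.
  have [g hg] := choice fsurj; exists g => // j; apply: finj; exact: hg.
split; first by have := bij_eq_card fbij; rewrite !card_ord.
exists f; split=> // j; rewrite vaE HE; congr (@para S M _).
apply/seteqP; split=> [s [j' Cs /finj <- //]|s Cs]; by exists j.
Qed.
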